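(* Let $f,h_1,\dots,h_p\colon\mathbb R^n\times\mathbb R^m\to\mathbb R$ be continuously differentiable, $I=\{1,\dots,\ell\}$, $J=\{\ell+1,\dots,p\}$, $\Gamma(x):=\{y\mid h_i(x,y)\le0\ (i\in I),\ h_i(x,y)=0\ (i\in J)\}$, $\varphi(x):=\inf\{f(x,y)\mid y\in\Gamma(x)\}$, $S(x):=\operatorname{argmin}\{f(x,y)\mid y\in\Gamma(x)\}$ and $h_0(x,y):=f(x,y)-\varphi(x)$, so that $S(x)=\{y\mid h_i(x,y)\le0\ (i\in I\cup\{0\}),\ h_i(x,y)=0\ (i\in J)\}$. Fix $\bar x\in\operatorname{dom}\Gamma$. (a) Assume (A1'): for each $x$, $f(x,\cdot)$ and $h_i(x,\cdot)$, $i\in I$, are convex and $h_i(x,\cdot)$, $i\in J$, are affine; (A2): $\Gamma$ is locally bounded at $\bar x$; RCPLD$_S$ holds at each point of $\{\bar x\}\times S(\bar x)$; and $\varphi$ is continuous at $\bar x$. Then $S$ is R-regular at each point of $\{\bar x\}\times S(\bar x)$, and $S$ has the Aubin property at all these points. (b) Let $\bar y\in S(\bar x)$ be such that $S$ is inner semicontinuous at $(\bar x,\bar y)$ and RCPLD$_S$ holds at $(\bar x,\bar y)$. Then $S$ is R-regular at $(\bar x,\bar y)$ and has the Aubin property at this point.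
   Context: $\operatorname{dom}\Gamma:=\{x\mid\Gamma(x)\neq\emptyset\}$; $\inf\emptyset=+\infty$ (so $h_0=-\infty$ off $\operatorname{dom}\Gamma$); $\operatorname{dist}(y,A):=\inf_{z\in A}\|z-y\|$, $=+\infty$ for $A=\emptyset$; $\mathbb B$ is the closed Euclidean unit ball. $\Gamma$ is locally bounded at $\bar x$ if there are a bounded $B$ and a neighborhood $V$ of $\bar x$ with $\Gamma(x)\subset B$ for $x\in V$. $S$ is R-regular at $(\bar x,\bar y)\in\operatorname{gph}S$ if there exist $\kappa>0$ and a neighborhood $U$ of $(\bar x,\bar y)$ with $\operatorname{dist}(y,S(x))\le\kappa\max\{0,\max_{i\in I\cup\{0\}}h_i(x,y),\max_{i\in J}|h_i(x,y)|\}$ for all $(x,y)\in U$. $S$ has the Aubin property at $(\bar x,\bar y)$ if there are neighborhoods $V,W$ of $\bar x,\bar y$ and $\kappa>0$ with $S(x)\cap W\subset S(x')+\kappa\|x-x'\|\mathbb B$ for all $x,x'\in V$. $S$ is inner semicontinuous at $(\bar x,\bar y)$ if for every $x^k\to\bar x$ there is $y^k\to\bar y$ with $y^k\in S(x^k)$ for large $k$. A pair of finite families $((a^i)_{i\in I_1},(b^i)_{i\in I_2})$ is positive-linearly dependent if there are $\alpha_i\ge0$, $\beta_i$, not all zero, with $\sum\alpha_ia^i+\sum\beta_ib^i=0$. For $(\bar x,\bar y)\in\operatorname{gph}S$ put $I(\bar x,\bar y):=\{i\in I\mid h_i(\bar x,\bar y)=0\}$ and $\nabla_yh_0:=\nabla_yf$.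 RCPLD$_S$ holds at $(\bar x,\bar y)$ if there are a neighborhood $U$ of $(\bar x,\bar y)$ and $\mathcal S\subset J$ such that: (i) $\{\nabla_yh_i(\bar x,\bar y)\mid i\in\mathcal S\}$ is a basis of the span of $\{\nabla_yh_i(\bar x,\bar y)\mid i\in J\}$; (ii) $(\nabla_yh_i(x,y))_{i\in J}$ has constant rank on $U$; (iii) for each $K\subset\{0\}\cup I(\bar x,\bar y)$ with $((\nabla_yh_i(\bar x,\bar y))_{i\in K},(\nabla_yh_i(\bar x,\bar y))_{i\in\mathcal S})$ positive-linearly dependent, $(\nabla_yh_i(x,y))_{i\in K\cup\mathcal S}$ is linearly dependent for each $(x,y)\in U$. *)

(* Defs.v *)
From HB Require Import structures.
From mathcomp Require Import all_boot all_order all_algebra.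
From mathcomp Require Import all_classical all_reals all_analysis.
Set Implicit Arguments. Unset Strict Implicit. Unset Printing Implicit Defensive.
Import Order.TTheory GRing.Theory Num.Theory.
Import numFieldNormedType.Exports.
Local Open Scope classical_set_scope.
Local Open Scope ring_scope.

Section Defs.
Variable R : realType.

Definition enorm k (v : 'rV[R]_k) : R := Num.sqrt (\sum_(j < k) (v 0 j) ^+ 2).

(* dist(y, A) = inf_{z in A} ||z - y||, = +oo for A empty *)
Definition edist k (y : 'rV[R]_k) (A : set 'rV[R]_k) : \bar R :=
  ereal_inf [set (enorm (z - y))%:E | z in A].

(* continuously differentiable on R^n x R^m: differentiable everywhere and
   the differential z |-> Dg(z) is continuous (tested on each direction,
   which in finite dimension is continuity in operator norm) *)
Definition C1 n m (g : 'rV[R]_n * 'rV[R]_m -> R) : Prop :=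
  (forall z, differentiable g z) /\
  (forall v : 'rV[R]_n * 'rV[R]_m, continuous (fun z => 'd g z v)).

Definition grad_y n m (g : 'rV[R]_n * 'rV[R]_m -> R) (x : 'rV[R]_n) (y : 'rV[R]_m)
  : 'rV[R]_m := \row_(j < m) 'd g (x, y) (0, delta_mx 0 j).

Definition convex_in m (g : 'rV[R]_m -> R) : Prop :=
  forall (y z : 'rV[R]_m) (t : R), 0 <= t -> t <= 1 ->
    g (t *: y + (1 - t) *: z) <= t * g y + (1 - t) * g z.

Definition affine_in m (g : 'rV[R]_m -> R) : Prop :=
  exists (a : 'rV[R]_m) (b : R), forall y, g y = \sum_(j < m) a 0 j * y 0 j + b.

Variables (n m p l : nat).
Variable f : 'rV[R]_n * 'rV[R]_m -> R.
Variable h : 'I_p -> 'rV[R]_n * 'rV[R]_m -> R.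
(* I = {i | i < l} (inequalities), J = {i | l <= i} (equalities), 0-based *)

Definition Gam (x : 'rV[R]_n) : set 'rV[R]_m :=
  [set y | (forall i : 'I_p, (i < l)%N -> h i (x, y) <= 0) /\
           (forall i : 'I_p, (l <= i)%N -> h i (x, y) = 0)].

Definition domGam : set 'rV[R]_n := [set x | Gam x !=set0].

Definition phi (x : 'rV[R]_n) : \bar R := ereal_inf [set (f (x, y))%:E | y in Gam x].

Definition Ssol (x : 'rV[R]_n) : set 'rV[R]_m :=
  [set y | Gam x y /\ forall z, Gam x z -> f (x, y) <= f (x, z)].

Definition h0 (x : 'rV[R]_n) (y : 'rV[R]_m) : \bar R := ((f (x, y))%:E - phi x)%E.

Definition resid (x : 'rV[R]_n) (y : 'rV[R]_m) : \bar R :=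
  Order.max (h0 x y)
    (\big[Order.max/0%E]_(i < p)
        (if (i < l)%N then (h i (x, y))%:E else (`|h i (x, y)|)%:E)).

Definition Rregular (xb : 'rV[R]_n) (yb : 'rV[R]_m) : Prop :=
  exists (kappa : R) (U : set ('rV[R]_n * 'rV[R]_m)),
    0 < kappa /\ nbhs (xb, yb) U /\
    forall x y, U (x, y) -> (edist y (Ssol x) <= kappa%:E * resid x y)%E.

Definition Aubin (xb : 'rV[R]_n) (yb : 'rV[R]_m) : Prop :=
  exists (V : set 'rV[R]_n) (W : set 'rV[R]_m) (kappa : R),
    nbhs xb V /\ nbhs yb W /\ 0 < kappa /\
    forall x x', V x -> V x' -> forall y, Ssol x y -> W y ->
      exists z, Ssol x' z /\ enorm (y - z) <= kappa * enorm (x - x').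

Definition inner_sc (xb : 'rV[R]_n) (yb : 'rV[R]_m) : Prop :=
  forall xk : nat -> 'rV[R]_n, xk @ \oo --> xb ->
    exists yk : nat -> 'rV[R]_m, yk @ \oo --> yb /\
      \forall k \near \oo, Ssol (xk k) (yk k).

Definition locally_bounded (xb : 'rV[R]_n) : Prop :=
  exists (M : R) (V : set 'rV[R]_n), nbhs xb V /\
    forall x, V x -> forall y, Gam x y -> enorm y <= M.

(* indices: None = 0 (the function h_0, with grad_y h_0 = grad_y f),
   Some i = index i of h *)
Definition gradS (x : 'rV[R]_n) (y : 'rV[R]_m) (i : option 'I_p) : 'rV[R]_m :=
  match i with None => grad_y f x y | Some i => grad_y (h i) x y end.

Definition Jset : {set option 'I_p} := [set Some i | i : 'I_p & (l <= i)%N].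

Definition Iactive (xb : 'rV[R]_n) (yb : 'rV[R]_m) : {set option 'I_p} :=
  [set Some i | i : 'I_p & ((i < l)%N && (h i (xb, yb) == 0))].

Definition lin_dep (A : {set option 'I_p}) (g : option 'I_p -> 'rV[R]_m) : Prop :=
  exists c : option 'I_p -> R, (exists i, i \in A /\ c i != 0) /\
    \sum_(i in A) c i *: g i = 0.

Definition span_in (A : {set option 'I_p}) (g : option 'I_p -> 'rV[R]_m)
  (v : 'rV[R]_m) : Prop :=
  exists c : option 'I_p -> R, v = \sum_(i in A) c i *: g i.

Definition pos_lin_dep (A1 A2 : {set option 'I_p}) (g : option 'I_p -> 'rV[R]_m)
  : Prop :=
  exists (al be : option 'I_p -> R),
    (forall i, i \in A1 -> 0 <= al i) /\
    ((exists i, i \in A1 /\ al i != 0) \/ (exists i, i \in A2 /\ be i != 0)) /\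
    \sum_(i in A1) al i *: g i + \sum_(i in A2) be i *: g i = 0.

Definition rankJ (x : 'rV[R]_n) (y : 'rV[R]_m) : nat :=
  \rank (\matrix_(i < p, j < m) (if (l <= i)%N then grad_y (h i) x y 0 j else 0)).

Definition RCPLD (xb : 'rV[R]_n) (yb : 'rV[R]_m) : Prop :=
  exists (U : set ('rV[R]_n * 'rV[R]_m)) (Sidx : {set option 'I_p}),
    nbhs (xb, yb) U /\ Sidx \subset Jset /\
    ~ lin_dep Sidx (gradS xb yb) /\
    (forall j, j \in Jset -> span_in Sidx (gradS xb yb) (gradS xb yb j)) /\
    (forall x y, U (x, y) -> rankJ x y = rankJ xb yb) /\
    (forall K : {set option 'I_p}, K \subset None |: Iactive xb yb ->
       pos_lin_dep K Sidx (gradS xb yb) ->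
       forall x y, U (x, y) -> lin_dep (K :|: Sidx) (gradS x y)).

End Defs.

(* Main.v *)
(* The key is an error bound: the distance from y to S(x) is controlled by the
   residual. Let q be a projection of y on S(x). Minimizing
   |z-y|^2/2 + |z-q|^2/2 + c * (squared violation) over a small ball around q and
   letting c be large gives approximate multipliers at a point z as close to q as
   wanted, without any constraint qualification. The constant rank of the equality
   gradients and a Caratheodory reduction make the family of gradients carrying
   these multipliers linearly independent; RCPLD then forces it to be
   positive-linearly independent at the reference point, so the multipliers are
   bounded by a constant times |y-q|. Pairing the multiplier equation with y - q
   bounds |y-q| by the residual, up to an error which is absorbed near the
   reference point, or which is absent in the convex case.

   Since the slices x = const are treated one at a time, no regularity of the
   optimal value is used. It is Lipschitz a posteriori: RCPLD_S contains the
   same qualification for Gamma, whose error bound yields nearby feasible points.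
   Together with the error bound for S this gives the Aubin property.

   In the convex case the same estimate, applied to y = ybar and localized around
   an arbitrary point of the compact set S(xbar), shows inner semicontinuity. *)
Require Import Defs.
From HB Require Import structures.
From mathcomp Require Import all_boot all_order all_algebra.
From mathcomp Require Import all_classical all_reals all_analysis.
From mathcomp Require Import lra ring.
Import Order.TTheory GRing.Theory Num.Theory.
Import numFieldNormedType.Exports.
Local Open Scope classical_set_scope.
Local Open Scope ring_scope.
Set Implicit Arguments. Unset Strict Implicit. Unset Printing Implicit Defensive.

(** * Euclidean space and continuity *)

Lemma near_forall (T : topologicalType) (I : finType) (z : T) (P : I -> T -> Prop) :
  (forall i, \forall w \near z, P i w) -> \forall w \near z, forall i, P i w.
Proof. exact: filter_forall. Qed.

Section Continuity.
Variables (R : realType) (T : topologicalType).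

Lemma continuous_addr (f g : T -> R) : continuous f -> continuous g ->
  continuous (fun t => f t + g t).
Proof. by move=> cf cg x; apply: cvgD; [exact: cf|exact: cg]. Qed.

Lemma continuous_mulr (f g : T -> R) : continuous f -> continuous g ->
  continuous (fun t => f t * g t).
Proof. by move=> cf cg x; apply: cvgM; [exact: cf|exact: cg]. Qed.

Lemma continuous_sqr (f : T -> R) : continuous f -> continuous (fun t => f t ^+ 2).
Proof. by move=> cf; exact: (continuous_mulr cf cf). Qed.

Lemma continuous_sumr (I : Type) (r : seq I) (P : pred I) (f : I -> T -> R) :
  (forall i, continuous (f i)) -> continuous (fun t => \sum_(i <- r | P i) f i t).
Proof. by move=> cf; apply: continuous_big => //; exact: add_continuous. Qed.

End Continuity.

Section Euclid.
Variables (R : realType) (k : nat).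
Implicit Types u v w : 'rV[R]_k.

Definition dotv u v : R := \sum_(j < k) u 0 j * v 0 j.

Lemma dotvC u v : dotv u v = dotv v u.
Proof. by apply: eq_bigr => j _; rewrite mulrC. Qed.

Lemma dotvDr u v w : dotv u (v + w) = dotv u v + dotv u w.
Proof. by rewrite -big_split; apply: eq_bigr => j _; rewrite mxE mulrDr. Qed.

Lemma dotvZr a u v : dotv u (a *: v) = a * dotv u v.
Proof. by rewrite mulr_sumr; apply: eq_bigr => j _; rewrite mxE mulrCA. Qed.

Lemma dotvNr u v : dotv u (- v) = - dotv u v.
Proof. by rewrite -scaleN1r dotvZr mulN1r. Qed.

Lemma dotvBr u v w : dotv u (v - w) = dotv u v - dotv u w.
Proof. by rewrite dotvDr dotvNr. Qed.

Lemma dotvDl u v w : dotv (u + v) w = dotv u w + dotv v w.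
Proof. by rewrite dotvC dotvDr !(dotvC w). Qed.

Lemma dotvBl u v w : dotv (u - v) w = dotv u w - dotv v w.
Proof. by rewrite dotvC dotvBr !(dotvC w). Qed.

Lemma dotvZl a u v : dotv (a *: u) v = a * dotv u v.
Proof. by rewrite dotvC dotvZr dotvC. Qed.

Lemma dotv0l v : dotv 0 v = 0.
Proof. by rewrite -(scale0r 0) dotvZl mul0r. Qed.

Lemma dotv_suml (T : finType) (P : pred T) (F : T -> 'rV[R]_k) v :
  dotv (\sum_(i | P i) F i) v = \sum_(i | P i) dotv (F i) v.
Proof.
by elim/big_rec2: _ => [|i y1 y2 _ <-]; rewrite ?dotv0l // dotvDl.
Qed.

Lemma norm_coord_le v j : `|v 0 j| <= `|v|.
Proof.
rewrite [leRHS]/Num.norm /= mx_normrE.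
exact: (le_bigmax _ (fun ij : 'I_1 * 'I_k => `|v ij.1 ij.2|) (0, j)).
Qed.

Lemma norm_rV_le v (b : R) : 0 <= b -> (forall j, `|v 0 j| <= b) -> `|v| <= b.
Proof.
move=> b0 vb; rewrite [leLHS]/Num.norm /= mx_normrE.
by apply/bigmax_leP; split => // -[i j] _ /=; rewrite (ord1 i).
Qed.

(** The norm [|v|] of a row vector is the maximum norm, whence the dimensional factor in this form
    of Cauchy-Schwarz; it recurs in the constants below. *)
Lemma dotv_le u v : `|dotv u v| <= k%:R * `|u| * `|v|.
Proof.
apply: le_trans (ler_norm_sum _ _ _) _.
have -> : k%:R * `|u| * `|v| = \sum_(j < k) `|u| * `|v|.
  by rewrite sumr_const card_ord -[RHS]mulr_natl mulrA.
by apply: ler_sum => j _; rewrite normrM ler_pM // norm_coord_le.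
Qed.

Lemma dotv_ge0 v : 0 <= dotv v v.
Proof. by apply: sumr_ge0 => j _; rewrite -expr2 sqr_ge0. Qed.

Lemma enormE v : enorm v = Num.sqrt (dotv v v).
Proof. by congr Num.sqrt; apply: eq_bigr => j _; rewrite expr2. Qed.

Lemma enorm_ge0 v : 0 <= enorm v.
Proof. exact: sqrtr_ge0. Qed.

Lemma enorm_sqr v : enorm v ^+ 2 = dotv v v.
Proof. by rewrite enormE sqr_sqrtr // dotv_ge0. Qed.

Lemma norm_le_enorm v : `|v| <= enorm v.
Proof.
apply: norm_rV_le => [|j]; first exact: enorm_ge0.
rewrite -(@ler_pXn2r _ 2%N) ?nnegrE ?enorm_ge0 // enorm_sqr real_normK ?num_real //.
rewrite /dotv (bigD1 j) //= -expr2 lerDl.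
by apply: sumr_ge0 => i _; rewrite -expr2 sqr_ge0.
Qed.

Lemma enorm_le_norm v : enorm v <= k%:R * `|v|.
Proof.
have kv0 : 0 <= k%:R * `|v| by rewrite mulr_ge0.
rewrite -(@ler_pXn2r _ 2%N) ?nnegrE ?enorm_ge0 // enorm_sqr.
apply: le_trans (ler_norm _) _; apply: le_trans (dotv_le _ _) _.
rewrite exprMn expr2 -[_ * `|v| * `|v|]mulrA -expr2 ler_wpM2r // ?sqr_ge0 //.
by rewrite -natrM ler_nat; case: (k) => // k'; rewrite leq_pmulr.
Qed.

Lemma enorm0 : enorm (0 : 'rV[R]_k) = 0.
Proof. by rewrite enormE dotv0l sqrtr0. Qed.

Lemma enormN v : enorm (- v) = enorm v.
Proof. by rewrite !enormE dotvNr dotvC dotvNr opprK. Qed.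

Lemma enormB u v : enorm (u - v) = enorm (v - u).
Proof. by rewrite -enormN opprB. Qed.

Lemma enorm_continuous : continuous (@enorm R k).
Proof.
move=> v; apply: (@continuous_comp _ _ _ (fun v : 'rV[R]_k => \sum_(j < k) v 0 j ^+ 2)).
  apply: continuous_sumr => j; apply: continuous_sqr; exact: coord_continuous.
exact: sqrt_continuous.
Qed.

End Euclid.

(** * Continuously differentiable functions *)

Lemma is_derive_line (R : realType) (V : normedModType R) (g : V -> R) (a v : V) (t : R) :
  differentiable g (a + t *: v) ->
  is_derive t 1 (fun s : R => g (a + s *: v)) ('d g (a + t *: v) v).
Proof.
move=> dg.
have dl : is_diff t (cst a + ( *:%R^~ v) : R -> V) (0 + ( *:%R^~ v)) by apply: is_diffD.
have dg' : is_diff ((cst a + ( *:%R^~ v) : R -> V) t) g ('d g (a + t *: v)) by exact: DiffDef.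
have dc := is_diff_comp dl dg'.
have dd : differentiable (fun s : R => g (a + s *: v)) t by case: dc.
apply: DeriveDef; first exact/derivable1_diffP.
by rewrite deriveE // [LHS](_ : _ = 'd (g \o (cst a + ( *:%R^~ v))) t 1) // diff_val /= add0r scale1r.
Qed.

Lemma MVT_line (R : realType) (V : normedModType R) (g : V -> R) (a b : V) :
  (forall z, differentiable g z) ->
  exists2 t, 0 <= t <= 1 & g b - g a = 'd g (a + t *: (b - a)) (b - a).
Proof.
move=> dg; pose q (s : R) := g (a + s *: (b - a)).
have dq (s : R) : is_derive s 1 q ('d g (a + s *: (b - a)) (b - a)) by exact: is_derive_line.
have cq : {within `[0, 1], continuous q}.
  apply: continuous_subspaceT => s; apply: differentiable_continuous.
  by apply/derivable1_diffP; case: (dq s).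
have [t] := MVT ltr01 (fun s _ => dq s) cq.
rewrite in_itv /= => /andP[t0 t1]; rewrite /q scale1r scale0r addr0 [a + (b - a)]addrC subrK => E.
by exists t; rewrite ?ltW //= E subr0 mulr1.
Qed.

Lemma segment_near (R : realType) (V : normedModType R) (a b c : V) (r t : R) :
  `|a - c| < r -> `|b - c| < r -> 0 <= t -> t <= 1 -> `|a + t *: (b - a) - c| < r.
Proof.
move=> ar br t0 t1.
have -> : a + t *: (b - a) - c = (1 - t) *: (a - c) + t *: (b - c).
  rewrite !scalerBr !scalerBl !scale1r !opprB -!addrA (addrCA (t *: c)) subrKC.
  by congr (_ + _); rewrite [RHS]addrA [RHS]addrC.
apply: le_lt_trans (ler_normD _ _) _; rewrite !normrZ !ger0_norm ?subr_ge0 //.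
(* Strictness is taken from the second term, so [t = 0] is treated apart. *)
have [->|tp] := eqVneq t 0; first by rewrite subr0 mul1r mul0r addr0.
have tp0 : 0 < t by rewrite lt_def tp.
apply: (@lt_le_trans _ _ ((1 - t) * r + t * r)); last by lra.
by rewrite ler_ltD // ?ler_wpM2l ?subr_ge0 ?ltr_pM2l // ltW.
Qed.

Section C1_functions.
Variables (R : realType) (n m : nat) (g : 'rV[R]_n * 'rV[R]_m -> R).
Hypothesis g_C1 : C1 g.

Lemma C1_continuous : continuous g.
Proof. by move=> z; apply: differentiable_continuous; case: g_C1 => + _; apply. Qed.

(** [C1] controls the differential one direction at a time; expansion on the finite basis of unit
    vectors turns this into estimates valid for all directions. *)
Lemma diff_pair_sum (z u : 'rV[R]_n * 'rV[R]_m) :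
  'd g z u = \sum_(i < n) u.1 0 i * 'd g z (delta_mx 0 i, 0) +
             \sum_(j < m) u.2 0 j * 'd g z (0, delta_mx 0 j).
Proof.
have {1}-> : u = \sum_(i < n) u.1 0 i *: ((delta_mx 0 i, 0) : 'rV[R]_n * 'rV[R]_m) +
              \sum_(j < m) u.2 0 j *: ((0, delta_mx 0 j) : 'rV[R]_n * 'rV[R]_m).
  rewrite [LHS](_ : _ = (u.1, 0) + (0, u.2)); last first.
    by case: u => u1 u2; congr pair; rewrite /= ?addr0 ?add0r.
  congr (_ + _).
    rewrite {1}[u.1]row_sum_delta; elim/big_rec2: _ => // i a b _ <-.
    by congr pair; rewrite /= ?scaler0 ?addr0.
  rewrite {1}[u.2]row_sum_delta; elim/big_rec2: _ => // i a b _ <-.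
  by congr pair; rewrite /= ?scaler0 ?addr0.
by rewrite linearD !linear_sum; congr (_ + _); apply: eq_bigr => j _; rewrite linearZ.
Qed.

Lemma diff_grad_y x y v : 'd g (x, y) (0, v) = dotv (grad_y g x y) v.
Proof.
rewrite diff_pair_sum /= big1 ?add0r => [|i _]; last by rewrite mxE mul0r.
by apply: eq_bigr => j _; rewrite mxE mulrC.
Qed.

Lemma near_diff_basis z e : 0 < e ->
  \forall w \near z,
    (forall i : 'I_n, `|'d g z (delta_mx 0 i, 0) - 'd g w (delta_mx 0 i, 0)| < e) /\
    (forall j : 'I_m, `|'d g z (0, delta_mx 0 j) - 'd g w (0, delta_mx 0 j)| < e).
Proof.
move=> e0; have cg v : \forall w \near z, `|'d g z v - 'd g w v| < e.
  by have /cvgrPdist_lt/(_ _ e0) := g_C1.2 v z.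
have cg1 : \forall w \near z, forall i : 'I_n,
    `|'d g z (delta_mx 0 i, 0) - 'd g w (delta_mx 0 i, 0)| < e.
  by apply: near_forall => i; exact: cg.
have cg2 : \forall w \near z, forall j : 'I_m,
    `|'d g z (0, delta_mx 0 j) - 'd g w (0, delta_mx 0 j)| < e.
  by apply: near_forall => j; exact: cg.
exact: filterI cg1 cg2.
Qed.

Lemma grad_y_continuous : continuous (fun z : 'rV[R]_n * 'rV[R]_m => grad_y g z.1 z.2).
Proof.
move=> z; apply/cvgrPdist_le => e e0.
apply: filterS (near_diff_basis z e0) => w [_ wj].
apply: norm_rV_le => [|j]; first exact: ltW.
by rewrite !mxE; case: z w wj => z1 z2 [w1 w2] /(_ j)/ltW.
Qed.

(** By the mean value theorem on the segment from [y'] to [y]: the gradients at the intermediate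
    point and at [z] are both close to the one at [(xb, yb)]. The base point [z] is free because
    multipliers will live at a penalized minimizer, distinct from [y] and [y']. *)
Lemma C1_strict_diff xb yb e : 0 < e ->
  exists2 r, 0 < r & forall x y y' z, `|x - xb| < r -> `|y - yb| < r ->
    `|y' - yb| < r -> `|z - yb| < r ->
    `|g (x, y) - g (x, y') - dotv (grad_y g x z) (y - y')| <= e * `|y - y'|.
Proof.
(* The 2 pays for two gradient comparisons and the dimension for [dotv_le]; the successor keeps the
   divisor positive when [m = 0]. *)
move=> e0; pose e1 := e / (2 * m.+1%:R).
have m0 : 0 < m.+1%:R :> R by rewrite ltr0n.
have e10 : 0 < e1 by rewrite divr_gt0 // mulr_gt0.
have /cvgrPdist_lt/(_ _ e10)/nbhs_ballP[r /= r0 rP] := @grad_y_continuous (xb, yb).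
exists r => // x y y' z xr yr y'r zr.
have near_grad u : `|u - yb| < r -> `|grad_y g xb yb - grad_y g x u| < e1.
  by move=> ur; apply: (rP (x, u)); split; rewrite -ball_normE /= distrC.
have [t /andP[t0 t1] ->] := @MVT_line _ _ g (x, y') (x, y) g_C1.1.
have -> : (x, y) - (x, y') = (0, y - y') :> 'rV[R]_n * 'rV[R]_m.
  by congr pair; rewrite subrr.
have -> : (x, y') + t *: (0, y - y') = (x, y' + t *: (y - y')) :> 'rV[R]_n * 'rV[R]_m.
  by congr pair; rewrite /= scaler0 addr0.
rewrite diff_grad_y -dotvBl; apply: le_trans (dotv_le _ _) _.
rewrite ler_wpM2r //.
have ur := segment_near y'r yr t0 t1.
have H1 := near_grad _ ur; have H2 := near_grad _ zr.
apply: (@le_trans _ _ (m%:R * (e1 + e1))).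
  rewrite ler_wpM2l // -[X in `|X|](subrKA (grad_y g xb yb)).
  apply: le_trans (ler_normD _ _) _; apply: lerD; apply: ltW.
    by rewrite distrC; exact: H1.
  exact: H2.
have -> : e = m.+1%:R * (e1 + e1) by rewrite /e1; field; rewrite gt_eqF.
by rewrite ler_wpM2r ?addr_ge0 ?ler_nat // ltW.
Qed.

Lemma C1_lipschitz zb : exists L r, [/\ 0 < L, 0 < r & forall z z',
  `|z - zb| < r -> `|z' - zb| < r -> `|g z - g z'| <= L * `|z - z'|].
Proof.
have /nbhs_ballP[r /= r0 rP] := near_diff_basis zb ltr01.
(* Near [zb] each basis derivative is at most 1 plus its size at [zb]. The leading 1 keeps [L]
   positive even when both sums are empty. *)
pose L := 1 + (\sum_(i < n) (1 + `|'d g zb (delta_mx 0 i, 0)|) +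
               \sum_(j < m) (1 + `|'d g zb (0, delta_mx 0 j)|)).
exists L, r; split => //.
  by rewrite ltr_pwDl // addr_ge0 // sumr_ge0 // => i _; rewrite addr_ge0.
move=> z z' zr z'r; have [t /andP[t0 t1] ->] := @MVT_line _ _ g z' z g_C1.1.
set w := z' + _.
have wr := segment_near z'r zr t0 t1.
have [w1 w2] : (forall i : 'I_n, `|'d g zb (delta_mx 0 i, 0) - 'd g w (delta_mx 0 i, 0)| < 1) /\
    (forall j : 'I_m, `|'d g zb (0, delta_mx 0 j) - 'd g w (0, delta_mx 0 j)| < 1).
  by apply: rP; rewrite -ball_normE /= distrC.
have le1 (a b : R) : `|a - b| < 1 -> `|b| <= 1 + `|a|.
  move=> ab; rewrite -[b](subrK a); apply: le_trans (ler_normD _ _) _.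
  by rewrite lerD2r ltW // distrC.
rewrite diff_pair_sum; set u := z - z'.
have u1 i : `|u.1 0 i| <= `|u|.
  by apply: le_trans (norm_coord_le _ _) _; rewrite [leRHS]prod_normE le_max lexx.
have u2 i : `|u.2 0 i| <= `|u|.
  by apply: le_trans (norm_coord_le _ _) _; rewrite [leRHS]prod_normE le_max lexx orbT.
apply: (@le_trans _ _ ((\sum_(i < n) (1 + `|'d g zb (delta_mx 0 i, 0)|) +
               \sum_(j < m) (1 + `|'d g zb (0, delta_mx 0 j)|)) * `|u|)); last first.
  by rewrite ler_wpM2r // lerDr.
rewrite mulrDl !mulr_suml; apply: le_trans (ler_normD _ _) _.
apply: lerD; apply: le_trans (ler_norm_sum _ _ _) _; apply: ler_sum => i _;
  rewrite normrM mulrC ler_pM //; exact: le1.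
Qed.

End C1_functions.

(** * Penalization of the projection problem *)

Section Compactness.
Variables (R : realType) (k : nat).

Lemma closed_le_fun (T : topologicalType) (F : T -> R) (c : R) :
  continuous F -> closed [set w | F w <= c].
Proof.
by move=> Fc; apply: (@closed_comp _ _ F [set x | x <= c]) => //; exact: closed_le.
Qed.

Lemma closed_ge_fun (T : topologicalType) (F : T -> R) (c : R) :
  continuous F -> closed [set w | c <= F w].
Proof.
by move=> Fc; apply: (@closed_comp _ _ F [set x | c <= x]) => //; exact: closed_ge.
Qed.

Lemma closed_eq_fun (T : topologicalType) (F : T -> R) (c : R) :
  continuous F -> closed [set w | F w = c].
Proof.
by move=> Fc; apply: (@closed_comp _ _ F [set x | x = c]) => //; exact: closed_eq.
Qed.

Lemma enorm_dist_continuous (c : 'rV[R]_k) : continuous (fun w : 'rV[R]_k => enorm (w - c)).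
Proof.
move=> w; apply: (@continuous_comp _ _ _ (fun w : 'rV[R]_k => w - c)).
  by apply: (@cvgB R 'rV[R]_k _ (nbhs w) _ id (cst c)); [exact: cvg_id|exact: cvg_cst].
exact: enorm_continuous.
Qed.

Lemma bounded_near_pt (A : set 'rV[R]_k) (c : 'rV[R]_k) (r : R) :
  (forall w, A w -> enorm (w - c) <= r) -> bounded_set A.
Proof.
move=> Ar; exists (r + `|c|); split; first exact: num_real.
move=> M rM w /Ar wr /=; rewrite -[w](subrK c) (le_trans (ler_normD _ _)) //.
rewrite (le_trans _ (ltW rM)) // lerD2r.
exact: le_trans (norm_le_enorm _) wr.
Qed.

Lemma EVT_min_closed (F : 'rV[R]_k -> R) (A : set 'rV[R]_k) (c : 'rV[R]_k) (r : R) :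
  A !=set0 -> closed A -> (forall w, A w -> enorm (w - c) <= r) -> continuous F ->
  exists2 z, A z & forall w, A w -> F z <= F w.
Proof.
move=> A0 cA Ar Fc.
have [||z zA zmin] := @compact_EVT_min _ _ F A A0.
- exact/bounded_closed_compact/cA/(bounded_near_pt Ar).
- exact: continuous_subspaceT.
by exists z => [|w wA]; [rewrite inE in zA|apply: zmin; rewrite inE].
Qed.

Lemma nearest_point (A : set 'rV[R]_k) (y : 'rV[R]_k) : A !=set0 -> closed A ->
  exists2 z, A z & forall w, A w -> enorm (z - y) <= enorm (w - y).
Proof.
move=> [a Aa] cA; have cy := @enorm_dist_continuous y.
have [||||z [zA zr] zmin] := @EVT_min_closed (fun w => enorm (w - y))
  (A `&` [set w | enorm (w - y) <= enorm (a - y)]) y (enorm (a - y)).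
- by exists a; split => /=.
- by apply: closedI => //; exact: closed_le_fun cy.
- by move=> w [].
- by [].
exists z => // w wA; have [wa|/ltW aw] := leP (enorm (w - y)) (enorm (a - y)).
  exact: zmin.
exact: le_trans zr aw.
Qed.

End Compactness.

Lemma is_derive_bigsum (R : realType) (I : Type) (r : seq I) (P : pred I)
    (f : I -> R -> R) (df : I -> R) (x : R) :
  (forall i, is_derive x 1 (f i) (df i)) ->
  is_derive x 1 (fun t => \sum_(i <- r | P i) f i t) (\sum_(i <- r | P i) df i).
Proof.
move=> fd; elim: r => [|i r IH].
  rewrite (_ : (fun t => _) = cst 0); first by rewrite big_nil; exact: is_derive_cst.
  by apply/funext => t; rewrite big_nil.
rewrite (_ : (fun t => _) = (fun t => (if P i then f i t else 0) +
    \sum_(j <- r | P j) f j t)); last first.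
  by apply/funext => t; rewrite big_cons; case: (P i); rewrite ?add0r.
rewrite big_cons; case: (P i); first exact: is_deriveD.
rewrite (_ : (fun t => _) = fun t => \sum_(j <- r | P j) f j t) //.
by apply/funext => t; rewrite add0r.
Qed.

Lemma is_derive_quadratic (R : realType) (a b c t : R) :
  is_derive t 1 (fun s => a + (s * b + s ^+ 2 * c)) (b + 2 * t * c).
Proof.
have D := is_deriveD (is_derive_cst a t (1 : R)) (is_deriveD
  (is_deriveZ b (is_derive_id t (1 : R))) (is_deriveZ c (is_deriveX 2 (is_derive_id t (1 : R))))).
have -> : b + 2 * t * c = 0 + (b *: 1 + c *: ((2%:R * t ^+ 1) *: 1)).
  by rewrite expr1 add0r /GRing.scale /=; ring.
suff -> : (fun s => a + (s * b + s ^+ 2 * c)) =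
  cst a + (b \*: (id : R -> R) + c \*: (id : R -> R) ^+ 2) by exact: D.
by apply/funext => s; rewrite mulrC [_ * c]mulrC.
Qed.

Section Penalty.
Variables (R : realType) (m : nat) (T : finType) (A B : {set T}).
Variables (g : T -> 'rV[R]_m -> R) (G : T -> 'rV[R]_m -> 'rV[R]_m).
Hypothesis g_cont : forall i, continuous (g i).
Hypothesis g_deriv : forall i z v (t : R),
  is_derive t 1 (fun s : R => g i (z + s *: v)) (dotv (G i (z + t *: v)) v).

Definition feasible : set 'rV[R]_m :=
  [set w | (forall i, i \in A -> g i w <= 0) /\ (forall j, j \in B -> g j w = 0)].

Definition violation w : R :=
  \sum_(i in A) (Num.max (g i w) 0) ^+ 2 + \sum_(j in B) g j w ^+ 2.

(* The second term makes [p] the unique limit of the penalized minimizers. *)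
Definition prox (y p w : 'rV[R]_m) : R := (enorm (w - y) ^+ 2 + enorm (w - p) ^+ 2) / 2.

Lemma violation_ge0 w : 0 <= violation w.
Proof. by rewrite addr_ge0 // sumr_ge0 // => i _; rewrite sqr_ge0. Qed.

Lemma violation_eq0 w : violation w = 0 -> feasible w.
Proof.
move=> /eqP; rewrite paddr_eq0 ?sumr_ge0 //; try by move=> i _; rewrite sqr_ge0.
move=> /andP[]; rewrite !psumr_eq0; try by move=> i _; rewrite sqr_ge0.
move=> /allP hA /allP hB; split => i iA.
  have := hA i (mem_index_enum i); rewrite iA /= sqrf_eq0 => /eqP.
  by move=> <-; rewrite le_max lexx.
by have := hB i (mem_index_enum i); rewrite iA /= sqrf_eq0 => /eqP.
Qed.

Lemma feasible_violation w : feasible w -> violation w = 0.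
Proof.
move=> [wA wB]; rewrite /violation !big1 ?addr0 // => i iA.
  by rewrite wB // expr0n.
by rewrite max_r ?expr0n // wA.
Qed.

Lemma violation_continuous : continuous violation.
Proof.
apply: continuous_addr; apply: continuous_sumr => i; apply: continuous_sqr => //.
by move=> w; apply: (continuous_max (g := cst 0)); [exact: g_cont|exact: cst_continuous].
Qed.

Lemma prox_continuous y p : continuous (prox y p).
Proof.
apply: continuous_mulr; last exact: cst_continuous.
by apply: continuous_addr; apply: continuous_sqr; exact: enorm_dist_continuous.
Qed.

Lemma feasible_closed : closed feasible.
Proof.
rewrite (_ : feasible = [set w | violation w = 0]).
  exact/closed_eq_fun/violation_continuous.
by apply/seteqP; split => w /=; [exact: feasible_violation|exact: violation_eq0].
Qed.

(** On the sphere of radius [eta] around [p], either [prox] exceeds its value at [p], or the point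
    is infeasible and, by compactness, its violation is bounded away from 0. A large weight
    therefore keeps the minimizer over the ball off the sphere. *)
Lemma penalty_interior y p eta : feasible p ->
  (forall w, feasible w -> enorm (p - y) <= enorm (w - y)) -> 0 < eta ->
  exists z c, [/\ 0 <= c, enorm (z - p) < eta &
    forall w, enorm (w - p) <= eta ->
      prox y p z + c * violation z <= prox y p w + c * violation w].
Proof.
move=> fp pmin eta0.
have prox0 w : 0 <= prox y p w by rewrite divr_ge0 // addr_ge0 // sqr_ge0.
have pp : prox y p p = enorm (p - y) ^+ 2 / 2.
  by rewrite /prox subrr enorm0 expr0n addr0.
(* [E] contains no feasible point: a feasible [w] on the sphere is at least as far from [y] as [p]
   is, and its distance to [p] adds [eta ^+ 2 / 2] to [prox]. *)
pose E := [set w | enorm (w - p) = eta] `&` [set w | prox y p w <= prox y p p].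
have E_pos w : E w -> 0 < violation w.
  move=> [we wp]; rewrite lt_def violation_ge0 andbT; apply/eqP => /violation_eq0 fw.
  move: wp; rewrite /= pp /prox we ler_pM2r // leNgt => /negP; apply.
  rewrite (@le_lt_trans _ _ (enorm (w - y) ^+ 2)) // ?ltrDl ?exprn_gt0 //.
  by rewrite ler_pXn2r ?nnegrE ?enorm_ge0 // pmin.
have [c c0 cP] : exists2 c, 0 < c & forall w, E w -> c <= violation w.
  have [[w Ew]|E0] := pselect (E !=set0); last first.
    by exists 1 => // w Ew; case: E0; exists w.
  have [||||z Ez zmin] := @EVT_min_closed _ _ violation E p eta.
  - by exists w.
  - apply: closedI; first exact/closed_eq_fun/enorm_dist_continuous.
    exact/closed_le_fun/prox_continuous.
  - by move=> u [/= -> _].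
  - exact: violation_continuous.
  by exists (violation z) => //; exact: E_pos.
(* With this weight the penalty on [E] is at least [prox y p p + 1], more than the whole objective
   at [p]. *)
pose k := (prox y p p + 1) / c.
have k0 : 0 <= k by rewrite divr_ge0 ?addr_ge0 // ltW.
have [||||z /= zD zmin] := @EVT_min_closed _ _ (fun w => prox y p w + k * violation w)
  [set w | enorm (w - p) <= eta] p eta.
- by exists p; rewrite /= subrr enorm0 ltW.
- exact/closed_le_fun/enorm_dist_continuous.
- by [].
- apply: continuous_addr; first exact: prox_continuous.
  by apply: continuous_mulr; [exact: cst_continuous|exact: violation_continuous].
exists z, k; split => //; rewrite lt_def zD andbT eq_sym; apply/eqP => ze.
have := zmin p; rewrite /= subrr enorm0 => /(_ (ltW eta0)).
rewrite (feasible_violation fp) mulr0 addr0; apply/negP; rewrite -ltNge.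
have [zp|pz] := leP (prox y p z) (prox y p p); last first.
  by rewrite ltr_wpDr // mulr_ge0 // violation_ge0.
rewrite ltr_wpDl // (@lt_le_trans _ _ (k * c)) ?ler_wpM2l ?cP //.
by rewrite /k divfK ?gt_eqF // ltrDl.
Qed.

(** First-order condition at the interior minimizer. The multipliers are the derivatives of the
    squared penalties, so an inequality carries a nonzero one only if it is strictly violated at
    [z]. *)
Lemma penalty_stationary y p eta : feasible p ->
  (forall w, feasible w -> enorm (p - y) <= enorm (w - y)) -> 0 < eta ->
  exists z (a b : T -> R), [/\ enorm (z - p) < eta,
    forall i, 0 <= a i /\ (a i != 0 -> 0 < g i z) &
    y - p - 2 *: (z - p) = \sum_(i in A) a i *: G i z + \sum_(j in B) b j *: G j z].
Proof.
move=> fp pmin eta0; have [z [c [c0 ze zmin]]] := penalty_interior fp pmin eta0.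
pose a i := 2 * c * Num.max (g i z) 0; pose b j := 2 * c * g j z.
exists z, a, b; split => // [i|].
  rewrite /a; case: (leP (g i z) 0) => [|gi]; first by rewrite mulr0 eqxx.
  by split => //; rewrite !mulr_ge0 // ltW.
(* [W] is the gradient of the penalized objective at [z]; it is tested against every direction
   [v]. *)
set Z := (X in _ = X); pose W := (z - y) + (z - p) + Z.
suff W0 : W = 0.
  apply/rowP => j; move/rowP: W0 => /(_ j); rewrite /W scaler_nat mulr2n !mxE => W0.
  by lra.
suff Wv v : dotv W v = 0.
  by apply/eqP; rewrite -normr_le0 (le_trans (norm_le_enorm W)) // enormE Wv sqrtr0.
pose line (t : R) := z + t *: v.
have line_d u (t : R) : is_derive t 1 (fun s => enorm (line s - u) ^+ 2) (2 * dotv (line t - u) v).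
  have sqE s : enorm (line s - u) ^+ 2 =
      dotv (z - u) (z - u) + (s * (2 * dotv (z - u) v) + s ^+ 2 * dotv v v).
    rewrite enorm_sqr /line addrAC; move: (z - u) => q.
    rewrite !(dotvDl, dotvDr, dotvZl, dotvZr) (dotvC v q).
    by ring.
  rewrite (_ : (fun s => _) = (fun s => dotv (z - u) (z - u) +
      (s * (2 * dotv (z - u) v) + s ^+ 2 * dotv v v))); last first.
    by apply/funext => s; exact: sqE.
  apply: (is_derive_eq (is_derive_quadratic _ _ _ _)).
  by rewrite /line addrAC [in RHS]dotvDl dotvZl; ring.
(* Where [g i z < 0] the positive part of [g i] vanishes near [z]; elsewhere it is
   replaced by [g i] itself. This majorizes the objective near [z], with equality
   at [z], and is smooth, so [z] is a critical point of it. *)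
pose A' := [set i in A | 0 <= g i z].
pose F (t : R) := prox y p (line t) +
  c * (\sum_(i in A') g i (line t) ^+ 2 + \sum_(j in B) g j (line t) ^+ 2).
pose dF (t : R) := (dotv (line t - y) v + dotv (line t - p) v) +
  c * (\sum_(i in A') 2 * g i (line t) * dotv (G i (line t)) v
       + \sum_(j in B) 2 * g j (line t) * dotv (G j (line t)) v).
have sqd i (t : R) : is_derive t 1 (fun s => g i (line s) ^+ 2)
    (2 * g i (line t) * dotv (G i (line t)) v).
  have Hi := g_deriv i z v t.
  rewrite (_ : (fun s => _) = (fun s => g i (z + s *: v)) ^+ 2); last first.
    by apply/funext => s.
  apply: (is_derive_eq (is_deriveX 2 Hi)).
  by rewrite expr1.
have Fd (t : R) : is_derive t 1 F (dF t).
  have D1 := is_deriveD (line_d y t) (line_d p t).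
  have D2 := is_deriveZ 2^-1 D1.
  have D3 := is_deriveD (is_derive_bigsum (index_enum T) (mem A') (fun i => sqd i t))
                        (is_derive_bigsum (index_enum T) (mem B) (fun i => sqd i t)).
  have D4 := is_deriveD D2 (is_deriveZ c D3).
  suff [-> ->] : F = (2^-1 \*: ((fun s => enorm (line s - y) ^+ 2) + (fun s => enorm (line s - p) ^+ 2))
      + c \*: ((fun s => \sum_(i in A') g i (line s) ^+ 2) + (fun s => \sum_(i in B) g i (line s) ^+ 2)))
    /\ dF t = 2^-1 *: (2 * dotv (line t - y) v + 2 * dotv (line t - p) v) +
      c *: (\sum_(i in A') 2 * g i (line t) * dotv (G i (line t)) v
       + \sum_(j in B) 2 * g j (line t) * dotv (G j (line t)) v) by exact: D4.
  split; first by apply/funext => s; rewrite /F /prox mulrC.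
  by rewrite /dF -mulrDr scalerA mulVf ?scale1r // pnatr_eq0.
have line0 : line 0 = z by rewrite /line scale0r addr0.
have sumA (h : T -> R) : \sum_(i in A') h i = \sum_(i in A) if 0 <= g i z then h i else 0.
  by rewrite [LHS]big_mkcond [RHS]big_mkcond; apply: eq_bigr => i _; rewrite inE;
     case: (i \in A); case: (0 <= g i z).
have F0 : F 0 = prox y p z + c * violation z.
  rewrite /F line0 sumA; congr (_ + _ * (_ + _)); apply: eq_bigr => i _.
  by case: (leP 0 (g i z)) => gi; rewrite ?expr0n.
have line_cont : continuous line.
  move=> t; apply: cvgD; first exact: cvg_cst.
  exact: scalel_continuous.
(* For small [t] the line stays in the ball where [z] is minimal, and the constraints negative at
   [z] remain negative. *)
have [d d0 dP] : exists2 d, 0 < d & forall t, `|t| < d ->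
    prox y p z + c * violation z <= F t.
  have near0 (h : 'rV[R]_m -> R) (r : R) : continuous h -> h z < r ->
      \forall t \near (0 : R), h (line t) < r.
    move=> hc hz; have : (h \o line) t @[t --> 0] --> h z.
      rewrite -[in h z]line0; apply: (@continuous_comp _ _ _ line h (0 : R)); first exact: line_cont.
      exact: hc.
    by move/cvgr_lt; apply.
  have near_dist := near0 _ _ (@enorm_dist_continuous _ _ p) ze.
  have near_neg : \forall t \near (0 : R), forall i, g i z < 0 -> g i (line t) < 0.
    apply: near_forall.
    move=> i; have [gi|gi] := ltP (g i z) 0; last by apply: filterE => t /=.
    by apply: filterS (near0 _ _ (@g_cont i) gi) => t ht _.
  have nd : nbhs (0 : R) [set t | enorm (line t - p) < eta /\
      forall i, g i z < 0 -> g i (line t) < 0] by exact: filterI.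
  have /nbhs_ballP [d /= d0 dP] := nd.
  exists d => // t td; have [|tp tneg] := dP t; first by rewrite -ball_normE /= sub0r normrN.
  apply: (le_trans (zmin _ (ltW tp))); rewrite /F lerD2l ler_wpM2l // lerD2r sumA.
  apply: ler_sum => i _; case: (leP 0 (g i z)) => gi.
    case: (leP (g i (line t)) 0) => // _; by rewrite expr0n sqr_ge0.
  by rewrite max_r ?expr0n // ltW // tneg.
have : is_derive (0 : R) (1 : R) F (0 : R).
  apply: (@derive1_at_min _ F (- d) d 0).
  - by rewrite ge0_cp // ltW.
  - by move=> t _; case: (Fd t).
  - by rewrite in_itv /= oppr_lt0 d0.
  - move=> t; rewrite in_itv /= => td; rewrite F0; apply: dP.
    by rewrite ltr_norml.
move=> /@derive_val; have /@derive_val -> := Fd 0.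
rewrite /dF line0 => dF0.
have ZE : dotv Z v = \sum_(i in A) dotv (a i *: G i z) v + \sum_(j in B) dotv (b j *: G j z) v.
  by rewrite /Z dotvDl !dotv_suml.
rewrite /W dotvDl (dotvDl (z - y)) ZE -[RHS]dF0; congr (_ + _).
rewrite mulrDr !mulr_sumr sumA; congr (_ + _); apply: eq_bigr => i _; rewrite dotvZl.
  by rewrite /a; case: (leP 0 (g i z)) => gi; ring.
by rewrite /b; ring.
Qed.

End Penalty.

(** * Linear algebra of multipliers *)

Section Linear_algebra.
Variables (R : realType) (m p : nat).
Implicit Types (A S K : {set option 'I_p}) (g : option 'I_p -> 'rV[R]_m) (a b : option 'I_p -> R).

Lemma lin_indep_eq0 A g a : ~ lin_dep A g -> \sum_(i in A) a i *: g i = 0 ->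
  forall i, i \in A -> a i = 0.
Proof.
move=> nA sA i iA; apply/eqP/negPn/negP => ai; apply: nA.
by exists a; split => //; exists i.
Qed.

Lemma sum_disjointU A S g a : [disjoint A & S]%B ->
  \sum_(i in A :|: S) a i *: g i = \sum_(i in A) a i *: g i + \sum_(i in S) a i *: g i.
Proof. by move=> dAS; rewrite -bigU //=; apply: eq_bigl => i; rewrite !inE. Qed.

Lemma sum_support A g a :
  \sum_(i in [set i in A | a i != 0]) a i *: g i = \sum_(i in A) a i *: g i.
Proof.
rewrite [LHS]big_mkcond [RHS]big_mkcond; apply: eq_bigr => i _; rewrite inE.
by case: (i \in A) => //=; case: eqP => //= ->; rewrite scale0r.
Qed.

Lemma caratheodory_pos S g : ~ lin_dep S g -> forall N A a b,
  (#|A| <= N)%N -> [disjoint A & S]%B -> (forall i, i \in A -> 0 < a i) ->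
  exists K a', [/\ K \subset A, forall i, i \in K -> 0 <= a' i, ~ lin_dep (K :|: S) g &
    \sum_(i in A) a i *: g i + \sum_(i in S) b i *: g i = \sum_(i in K :|: S) a' i *: g i].
Proof.
move=> nS; elim=> [|N IH] A a b cA dAS a_gt0.
  exists finset.set0, b; rewrite finset.set0U; split => //; first exact: finset.sub0set.
    by move=> i; rewrite inE.
  by move: cA; rewrite leqn0 cards_eq0 => /eqP ->; rewrite finset.big_set0 add0r.
have [[e [[i3 [i3AS ei3]] e0]]|nAS] := pselect (lin_dep (A :|: S) g); last first.
  exists A, (fun i => if i \in A then a i else b i); split => //.
    by move=> i iA; rewrite iA ltW // a_gt0.
  rewrite sum_disjointU //; congr (_ + _); apply: eq_bigr => i iA; first by rewrite iA.
  by rewrite (disjointFl dAS iA).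
(* Up to a global sign change, the dependence has a positive coefficient on [A]. *)
have [c [i1 [i1A ci1] c0]] : exists c, exists2 i, i \in A /\ 0 < c i &
    \sum_(i in A :|: S) c i *: g i = 0.
  have [i2 i2A ei2] : exists2 i, i \in A & e i != 0.
    apply: contrapT => ne; have eA0 i : i \in A -> e i = 0.
      by move=> iA; apply/eqP/negPn/negP => ei; apply: ne; exists i.
    move: e0; rewrite sum_disjointU // big1 ?add0r => [eS|i /eA0 ->]; last by rewrite scale0r.
    move: i3AS ei3; rewrite inE => /orP[/eA0 ->|i3S]; first by rewrite eqxx.
    by rewrite (lin_indep_eq0 nS eS i3S) eqxx.
  case: (ltgtP (e i2) 0) => ei; last by rewrite ei eqxx in ei2.
    exists (fun i => - e i), i2; rewrite ?oppr_gt0 //.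
    by under eq_bigr do rewrite scaleNr; rewrite sumrN e0 oppr0.
  by exists e, i2.
have PI : (i1 \in A) && (0 < c i1) by rewrite i1A.
case: (@arg_minP _ _ _ i1 (fun i => (i \in A) && (0 < c i)) (fun i => a i / c i) PI).
(* Ratio test: the least [a i / c i] over positive [c i] is the largest step preserving the signs,
   and it cancels the coefficient of [i0]. *)
move=> i0 /andP[i0A ci0] i0min; pose t := a i0 / c i0.
have t0 : 0 <= t by rewrite divr_ge0 // ltW // a_gt0.
pose a' i := a i - t * c i; pose b' i := b i - t * c i.
have a'0 i : i \in A -> 0 <= a' i.
  move=> iA; rewrite subr_ge0; have [ci|ci] := ltP 0 (c i).
    by rewrite -ler_pdivlMr // i0min // iA.
  by rewrite (@le_trans _ _ 0) ?mulr_ge0_le0 // ltW // a_gt0.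
have sub : [set i in A | a' i != 0] \subset A :\ i0.
  apply/fintype.subsetP => i; rewrite !inE => /andP[iA]; rewrite iA andbT.
  by apply: contraNneq => ->; rewrite /a' /t divfK ?subrr // gt_eqF.
have [||i|K [a2 [KA a2K nK E]]] := IH [set i in A | a' i != 0] a' b'.
- rewrite -ltnS (leq_trans _ cA) // (leq_ltn_trans (subset_leq_card sub)) //.
  by rewrite [in ltnRHS](cardsD1 i0) i0A.
- by apply: disjointWl dAS; apply/fintype.subsetP => i; rewrite inE => /andP[].
- by rewrite inE => /andP[iA ai]; rewrite lt_def ai a'0.
exists K, a2; split => //.
  by apply: fintype.subset_trans KA _; apply/fintype.subsetP => i; rewrite inE => /andP[].
rewrite -E sum_support /a' /b'.
under [X in _ = X + _]eq_bigr do rewrite scalerBl -scalerA.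
under [X in _ = _ + X]eq_bigr do rewrite scalerBl -scalerA.
rewrite !sumrB -!scaler_sumr addrACA -opprD -scalerDr -sum_disjointU //.
by rewrite c0 scaler0 subr0.
Qed.

(** Restricting to the support of [a] first records that every retained index had a nonzero original
    coefficient, which later means a violated constraint. *)
Lemma caratheodory A S g a b : ~ lin_dep S g -> [disjoint A & S]%B ->
  (forall i, i \in A -> 0 <= a i) ->
  exists K a', [/\ K \subset A, forall i, i \in K -> a i != 0 /\ 0 <= a' i,
    ~ lin_dep (K :|: S) g &
    \sum_(i in A) a i *: g i + \sum_(i in S) b i *: g i = \sum_(i in K :|: S) a' i *: g i].
Proof.
move=> nS dAS a_ge0; have subA : [set i in A | a i != 0] \subset A.
  by apply/fintype.subsetP => i; rewrite inE => /andP[].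
have [||K [a' [KA a'K nK E]]] :=
  @caratheodory_pos S g nS _ [set i in A | a i != 0] a b (leqnn _).
- exact: disjointWl dAS.
- by move=> i; rewrite inE => /andP[iA ai]; rewrite lt_def ai a_ge0.
exists K, a'; split => //; first exact: fintype.subset_trans KA subA.
  move=> i iK; split; last exact: a'K.
  by move/fintype.subsetP: KA => /(_ i iK); rewrite inE => /andP[].
by rewrite -E sum_support.
Qed.

Section Rank.
Variables (l : nat) (S : {set option 'I_p}).
Hypothesis SJ : S \subset Jset p l.

(** For [g] the gradients at a point, this is the matrix whose rank is [rankJ]; rows of inequality
    indices are zero. *)
Let MJ g := \matrix_(i < p, j < m) (if (l <= i)%N then g (Some i) 0 j else 0).
(* Left multiplication by [E] keeps the rows of [MJ g] indexed by [S]. *)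
Let E : 'M[R]_p := \matrix_(i, k) (if (i == k) && (Some i \in S) then 1 else 0).

Lemma mulmx_selector g (D : 'rV[R]_p) :
  D *m (E *m MJ g) = \sum_(i in S) (if i is Some k then D 0 k else 0) *: g i.
Proof.
have -> : \sum_(i in S) (if i is Some k then D 0 k else 0) *: g i =
    \sum_(k < p | Some k \in S) D 0 k *: g (Some k).
  rewrite [LHS]big_mkcond (bigD1 None) //= [X in X + _](_ : _ = 0); last first.
    by case: ifP => // _; rewrite scale0r.
  rewrite add0r [RHS]big_mkcond /=.
  rewrite (reindex_omap (@Some 'I_p) id) //=; last by case.
  by apply: eq_bigl => i; rewrite eqxx.
rewrite mulmx_sum_row [RHS]big_mkcond; apply: eq_bigr => k _.
have -> : row k (E *m MJ g) = if Some k \in S then g (Some k) else 0.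
  apply/rowP => j; rewrite !mxE (bigD1 k) //= big1 => [|i ik]; last first.
    by rewrite !mxE eq_sym (negPf ik) andFb mul0r.
  rewrite !mxE eqxx andTb addr0; case: ifPn => kS; last by rewrite mul0r mxE.
  move/fintype.subsetP: SJ => /(_ _ kS); rewrite /Jset => /imsetP[k' + [->]].
  by rewrite inE => ->; rewrite mul1r.
by case: ifP; rewrite ?scaler0.
Qed.

(** Independence of the rows in [S] says that the row space of [E] meets the left kernel of [MJ g]
    trivially. The resulting rank does not depend on [g], which lets two points be compared. *)
Lemma rank_selector g : ~ lin_dep S g -> \rank (E *m MJ g) = \rank E.
Proof.
move=> nS; rewrite -(mxrank_mul_ker E (MJ g)).
suff -> : (E :&: kermx (MJ g))%MS = 0 by rewrite mxrank0 addn0.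
apply/eqP/rowV0P => v; rewrite sub_capmx => /andP[/submxP[D ->] /sub_kermxP].
rewrite -mulmxA mulmx_selector => /(lin_indep_eq0 nS) DS.
apply/rowP => k; rewrite !mxE (bigD1 k) //= big1 ?addr0 => [|i ik]; last first.
  by rewrite mxE (negPf ik) andFb mulr0.
by rewrite mxE eqxx andTb; case: (boolP (Some k \in S)) => [/DS /= ->|_]; rewrite ?mul0r ?mulr0.
Qed.

(** At [g0] the rows in [S] span all rows, so the common rank is that of [E]. At [g1] the rows in
    [S] span a subspace of this same dimension, hence the whole row space. *)
Lemma span_of_rank_eq g0 g1 : ~ lin_dep S g0 -> ~ lin_dep S g1 ->
  (forall j, j \in Jset p l -> span_in S g0 (g0 j)) -> \rank (MJ g1) = \rank (MJ g0) ->
  forall j, j \in Jset p l -> span_in S g1 (g1 j).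
Proof.
move=> n0 n1 sp0 r10.
have M0 : (MJ g0 <= E *m MJ g0)%MS.
  apply/row_subP => i; case: (leqP l i) => li; last first.
    rewrite (_ : row i _ = 0) ?sub0mx //.
    by apply/rowP => j; rewrite !mxE leqNgt li.
  have [|c cE] := sp0 (Some i); first by apply/imsetP; exists i => //; rewrite inE.
  have -> : row i (MJ g0) = g0 (Some i) by apply/rowP => j; rewrite !mxE li.
  apply/submxP; exists (\row_k c (Some k)); rewrite mulmx_selector cE.
  apply: eq_bigr => -[k|] kS; first by rewrite mxE.
  by move/fintype.subsetP: SJ => /(_ _ kS) /imsetP[].
have r0 : \rank (MJ g0) = \rank E.
  rewrite -(rank_selector n0); apply/eqP; rewrite eqn_leq (mxrankS M0).
  by rewrite mxrankS ?submxMl.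
have M1 : (MJ g1 <= E *m MJ g1)%MS.
  by rewrite -(mxrank_leqif_sup (submxMl E (MJ g1))) rank_selector // r10 r0.
move=> _ /imsetP[j + ->]; rewrite inE => lj.
have /submxP[D DE] : (g1 (Some j) <= E *m MJ g1)%MS.
  have -> : g1 (Some j) = row j (MJ g1) by apply/rowP => k; rewrite !mxE lj.
  exact: submx_trans (row_sub _ _) M1.
by exists (fun i => if i is Some k then D 0 k else 0); rewrite DE mulmx_selector.
Qed.

End Rank.
End Linear_algebra.

(** * Bounds on multipliers, uniform near a reference point *)

Section Multipliers.
Variables (R : realType) (X : topologicalType) (m p : nat).
Variables (G : option 'I_p -> X -> 'rV[R]_m) (w0 : X).
Hypothesis G_cont : forall i, G i w @[w --> w0] --> G i w0.
Implicit Types (K S : {set option 'I_p}) (a : option 'I_p -> R).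

(** The norm of the combination is continuous and positive on the compact set of normalized
    multipliers, hence bounded below there; homogeneity does the rest. The parameter [b] is the
    maximum norm of the multipliers. *)
Lemma multiplier_lower_bound K S :
  (forall a, (forall i, i \in K -> 0 <= a i) -> \sum_(i in K :|: S) a i *: G i w0 = 0 ->
    forall i, i \in K :|: S -> a i = 0) ->
  exists2 c, 0 < c & forall a b, (forall i, i \in K -> 0 <= a i) ->
    (forall i, i \in K :|: S -> `|a i| <= b) -> (exists2 i, i \in K :|: S & `|a i| = b) ->
    c * b <= `|\sum_(i in K :|: S) a i *: G i w0|.
Proof.
move=> indep; pose N := #|{: option 'I_p}|.
(* Multipliers are encoded as row vectors through [enum_rank] so that compactness is available. *)
pose F (u : 'rV[R]_N) := `|\sum_(i in K :|: S) u 0 (enum_rank i) *: G i w0|.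
have Fc : continuous F.
  move=> u; apply: (@continuous_comp _ _ _
    (fun u : 'rV[R]_N => \sum_(i in K :|: S) u 0 (enum_rank i) *: G i w0) (fun v => `|v|)).
    apply: continuous_big => [|i _]; first exact: add_continuous.
    move=> v; apply: (@continuous_comp _ _ _ (fun v : 'rV[R]_N => v 0 (enum_rank i))
      (fun s => s *: G i w0)); [exact: coord_continuous|exact: scalel_continuous].
  exact: norm_continuous.
pose Q := [set u : 'rV[R]_N | `|u| = 1] `&`
  [set u | forall j, enum_val j \in K -> 0 <= u 0 j] `&`
  [set u | forall j, enum_val j \notin K :|: S -> u 0 j = 0].
have cQ : closed Q.
  apply: closedI; first apply: closedI.
  - exact/closed_eq_fun/norm_continuous.
  - rewrite [X in closed X](_ : _ = \bigcap_(j in [set j | enum_val j \in K]) [set u : 'rV[R]_N | 0 <= u 0 j]).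
      by apply: closed_bigI => j _; apply: closed_ge_fun; exact: coord_continuous.
    by apply/seteqP; split => u /= uP j; exact: uP.
  rewrite [X in closed X](_ : _ = \bigcap_(j in [set j | enum_val j \notin K :|: S]) [set u : 'rV[R]_N | u 0 j = 0]).
    by apply: closed_bigI => j _; apply: closed_eq_fun; exact: coord_continuous.
  by apply/seteqP; split => u /= uP j; exact: uP.
have Fpos u : Q u -> 0 < F u.
  move=> [[u1 uK] uKS]; rewrite lt_def normr_ge0 andbT normr_eq0; apply/eqP => u0.
  have z := indep (fun i => u 0 (enum_rank i)) _ u0.
  suff : `|u| <= 0 by rewrite u1 ler10.
  apply: norm_rV_le => // j; case: (boolP (enum_val j \in K :|: S)) => jKS.
    rewrite -[j]enum_valK z ?normr0 // => i iK.
    by apply: uK; rewrite enum_rankK.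
  by rewrite uKS // normr0.
have [c c0 cF] : exists2 c, 0 < c & forall u, Q u -> c <= F u.
  (* [Q] is empty when [K :|: S] is. *)
  have [Q0|Q0] := pselect (Q !=set0); last first.
    by exists 1 => // u Qu; case: Q0; exists u.
  have [u Qu umin] : exists2 z, Q z & forall w, Q w -> F z <= F w.
    apply: (@EVT_min_closed _ _ F Q 0 N%:R) => // w [[w1 _] _].
    by rewrite subr0 (le_trans (enorm_le_norm _)) // w1 mulr1.
  by exists (F u) => //; exact: Fpos.
exists c => // a b a_ge0 ab [i0 i0KS ai0].
have [b0|b_neq0] := eqVneq b 0; first by rewrite b0 mulr0.
have b_gt0 : 0 < b by rewrite lt_def b_neq0 -ai0 normr_ge0.
pose u : 'rV[R]_N := \row_j (if enum_val j \in K :|: S then b^-1 * a (enum_val j) else 0).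
have Qu : Q u.
  split; first split.
  - apply/eqP; rewrite eq_le; apply/andP; split.
      apply: norm_rV_le => // j; rewrite mxE; case: ifP => jKS; last by rewrite normr0.
      rewrite normrM normfV (gtr0_norm b_gt0) mulrC ler_pdivrMr // mul1r.
      exact: ab.
    apply: le_trans (norm_coord_le u (enum_rank i0)).
    by rewrite mxE enum_rankK i0KS normrM normfV (gtr0_norm b_gt0) ai0 mulVf.
  - move=> j jK; rewrite mxE; case: ifP => // _; rewrite mulr_ge0 ?invr_ge0 ?a_ge0 //.
    exact: ltW.
  - by move=> j jKS; rewrite mxE (negPf jKS).
have := cF u Qu; rewrite -ler_pdivlMr // => /le_trans; apply.
rewrite /F (_ : \sum_(i in _) _ = b^-1 *: \sum_(i in K :|: S) a i *: G i w0); last first.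
  rewrite scaler_sumr; apply: eq_bigr => i iKS.
  by rewrite mxE enum_rankK iKS scalerA.
by rewrite normrZ normfV (gtr0_norm b_gt0) mulrC.
Qed.

Lemma multiplier_bound K S :
  (forall a, (forall i, i \in K -> 0 <= a i) -> \sum_(i in K :|: S) a i *: G i w0 = 0 ->
    forall i, i \in K :|: S -> a i = 0) ->
  exists2 c, 0 < c & \forall w \near w0, forall a, (forall i, i \in K -> 0 <= a i) ->
    forall i, i \in K :|: S -> `|a i| <= c * `|\sum_(i in K :|: S) a i *: G i w|.
Proof.
move=> /multiplier_lower_bound [c c0 cP].
(* Moving each gradient by less than [e] changes the combination by at most [c / 2] times the
   largest multiplier, half of the lower bound. *)
pose N := #|{: option 'I_p}|; pose e := c / 2 / N.+1%:R.
have N0 : 0 < N.+1%:R :> R by rewrite ltr0n.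
have e0 : 0 < e by rewrite !divr_gt0.
exists (2 / c); first exact: divr_gt0.
have near_G : \forall w \near w0, forall i, `|G i w0 - G i w| < e.
  apply: near_forall => i.
  by have /cvgrPdist_lt/(_ _ e0) := @G_cont i.
apply: filterS near_G => w wG a a_ge0 i1 i1KS.
have [i0 i0KS i0max] : exists2 i, i \in K :|: S & forall j, j \in K :|: S -> `|a j| <= `|a i|.
  by case: (@arg_maxP _ _ _ i1 (fun i => i \in K :|: S) (fun i => `|a i|) i1KS) => i; exists i.
apply: le_trans (i0max _ i1KS) _; set b := `|a i0|.
have lb : c * b <= `|\sum_(i in K :|: S) a i *: G i w0|.
  by apply: cP => //; exists i0.
have err : `|\sum_(i in K :|: S) a i *: G i w0 - \sum_(i in K :|: S) a i *: G i w| <= c / 2 * b.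
  rewrite -sumrB; apply: le_trans (ler_norm_sum _ _ _) _.
  apply: (@le_trans _ _ (\sum_(i in K :|: S) b * e)).
    apply: ler_sum => i iKS; rewrite -scalerBr normrZ ler_pM //; first exact: i0max.
    exact/ltW/wG.
  rewrite sumr_const -[leLHS]mulr_natl.
  have -> : c / 2 * b = N.+1%:R * (b * e) by rewrite /e; field; rewrite gt_eqF.
  apply: ler_wpM2r; first by rewrite mulr_ge0 ?normr_ge0 // ltW.
  by rewrite ler_nat (leq_trans (max_card _)).
have tri : `|\sum_(i in K :|: S) a i *: G i w0| <=
    c / 2 * b + `|\sum_(i in K :|: S) a i *: G i w|.
  rewrite -[X in `|X| <= _](subrK (\sum_(i in K :|: S) a i *: G i w)).
  by rewrite (le_trans (ler_normD _ _)) // lerD2r.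
have H : c * b / 2 <= `|\sum_(i in K :|: S) a i *: G i w| by lra.
have -> : b = 2 / c * (c * b / 2) by field; rewrite gt_eqF.
by apply: ler_wpM2l H; rewrite ltW // divr_gt0.
Qed.

End Multipliers.

(** * Projections under RCPLD *)

Section Projection.
Variables (R : realType) (m p l : nat).
Implicit Types (Act S A K : {set option 'I_p}) (gr : option 'I_p -> 'rV[R]_m).

(** This is what RCPLD leaves at one point near the reference point. The bound is asked only for
    independent families, which is what the Caratheodory reduction delivers. *)
Definition good_gradients Act S (c : R) gr : Prop :=
  [/\ ~ lin_dep S gr,
    forall j, j \in Jset p l -> span_in S gr (gr j) &
    forall K (a : option 'I_p -> R), K \subset Act -> (forall i, i \in K -> 0 <= a i) ->
      ~ lin_dep (K :|: S) gr ->
      forall i, i \in K :|: S -> `|a i| <= c * `|\sum_(i in K :|: S) a i *: gr i| ].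

Lemma sum_span (B S : {set option 'I_p}) gr (b : option 'I_p -> R) :
  (forall j, j \in B -> span_in S gr (gr j)) ->
  exists b', \sum_(j in B) b j *: gr j = \sum_(i in S) b' i *: gr i.
Proof.
move=> sp; have /choice [e eP] : forall j, exists c : option 'I_p -> R,
    j \in B -> gr j = \sum_(i in S) c i *: gr i.
  by move=> j; case: (boolP (j \in B)) => [/sp [c cE]|_]; [exists c | exists (fun=> 0)].
exists (fun i => \sum_(j in B) b j * e j i).
under [RHS]eq_bigr do rewrite scaler_suml.
rewrite exchange_big /=; apply: eq_bigr => j jB.
by rewrite [in LHS](eP j jB) scaler_sumr; apply: eq_bigr => i _; rewrite scalerA.
Qed.

Variables (A Act S : {set option 'I_p}) (c : R).
Variables (g : option 'I_p -> 'rV[R]_m -> R) (G : option 'I_p -> 'rV[R]_m -> 'rV[R]_m).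
Hypothesis g_cont : forall i, continuous (g i).
Hypothesis g_deriv : forall i z v (t : R),
  is_derive t 1 (fun s : R => g i (z + s *: v)) (dotv (G i (z + t *: v)) v).
Hypothesis SJ : S \subset Jset p l.
Hypothesis AJ : [disjoint A & Jset p l]%B.
Hypothesis c_ge0 : 0 <= c.
Variables (y q : 'rV[R]_m) (eta : R).
Hypothesis q_feas : feasible A (Jset p l) g q.
Hypothesis q_min : forall w, feasible A (Jset p l) g w -> enorm (q - y) <= enorm (w - y).
Hypothesis eta_gt0 : 0 < eta.
Hypothesis good : forall z, enorm (z - q) < eta ->
  good_gradients Act S c (G ^~ z) /\ forall i, i \in A -> 0 < g i z -> i \in Act.

(** The equality part of the stationarity equation is rewritten over [S], the family is reduced to
    an independent one, and the last clause of [good_gradients] then bounds the multipliers. *)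
Lemma approximate_KKT : exists z K (a : option 'I_p -> R),
  [/\ enorm (z - q) < eta, forall i, i \in K -> [/\ i \in A, 0 <= a i & 0 < g i z],
   forall i, i \in K :|: S -> `|a i| <= c * `|y - q - 2 *: (z - q)| &
   y - q - 2 *: (z - q) = \sum_(i in K :|: S) a i *: G i z ].
Proof.
have [z [a [b [zq aP E]]]] := penalty_stationary g_cont g_deriv q_feas q_min eta_gt0.
have [[nS sp mult] act] := good zq.
have [b' bE] := @sum_span (Jset p l) S (G ^~ z) b sp.
have dAS : [disjoint A & S]%B by apply: disjointWr AJ.
have [|K [a' [KA a'P nK E']]] := @caratheodory _ _ _ A S (G ^~ z) a b' nS dAS.
  by move=> i _; case: (aP i).
have KP i : i \in K -> [/\ i \in A, 0 <= a' i & 0 < g i z].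
  move=> iK; have [ai a'i] := a'P i iK; split => //.
    by move/fintype.subsetP: KA; apply.
  by case: (aP i) => _; apply.
exists z, K, a'; split => //; last by rewrite E bE E'.
rewrite E bE E' => i iKS; apply: mult => //.
  by apply/fintype.subsetP => k /KP [kA _ kz]; exact: act.
by move=> k /KP [].
Qed.

(** With [d = enorm (q - y)], pairing the multiplier equation with [y - q] gives [d ^+ 2] minus
    twice [dotv (z - q) (y - q)]; the bound on [eta] keeps the latter below [d ^+ 2 / 2]. Violated
    inequalities need only a one-sided bound, as their multipliers are nonnegative. *)
Lemma projection_estimate : enorm (q - y) != 0 -> eta <= enorm (q - y) / (4 * m.+1%:R) ->
  exists2 z, enorm (z - q) < eta & forall t, 0 <= t ->
    (forall i, i \in A -> 0 < g i z -> dotv (G i z) (y - q) <= t) ->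
    (forall j, j \in S -> `|dotv (G j z) (y - q)| <= t) ->
    enorm (q - y) <= 6 * p.+1%:R * c * t.
Proof.
move=> d0 eta_le; have [z [K [a [zq KP a_le E]]]] := approximate_KKT.
exists z => // t t0 KT ST; set d := enorm (q - y) in d0 eta_le *.
have dpos : 0 < d by rewrite lt_def d0 enorm_ge0.
have m0 : 0 < m.+1%:R :> R by rewrite ltr0n.
have qy : `|y - q| <= d by rewrite /d enormB norm_le_enorm.
have zqn : `|z - q| <= d / (4 * m.+1%:R).
  by rewrite (le_trans (norm_le_enorm _)) // ltW // (lt_le_trans zq).
have zqd : `|z - q| <= d.
  have m1 : 1 <= m.+1%:R :> R by rewrite ler1n.
  by apply: le_trans zqn _; rewrite ler_pdivrMr ?mulr_gt0 //; nra.
have wn : `|y - q - 2 *: (z - q)| <= 3 * d.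
  rewrite (le_trans (ler_normB _ _)) // normrZ ger0_norm //.
  by lra.
have dd : d ^+ 2 = dotv (y - q) (y - q) by rewrite /d enormB enorm_sqr.
have zdot : dotv (z - q) (y - q) <= d ^+ 2 / 4.
  rewrite (le_trans (ler_norm _)) // (le_trans (dotv_le _ _)) //.
  apply: (@le_trans _ _ (m%:R * (d / (4 * m.+1%:R)) * d)).
    by rewrite ler_pM ?mulr_ge0 ?normr_ge0 // ler_wpM2l.
  have -> : d ^+ 2 / 4 = m.+1%:R * (d / (4 * m.+1%:R)) * d by field; rewrite gt_eqF.
  apply: ler_wpM2r; first exact: ltW.
  by apply: ler_wpM2r; rewrite ?ler_nat // ltW // divr_gt0 // mulr_gt0.
(* At most [p.+1] terms, each with a multiplier of size at most [c * (3 * d)] and a pairing at most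
   [t]. *)
have sum_le : dotv (y - q - 2 *: (z - q)) (y - q) <= p.+1%:R * (c * (3 * d) * t).
  rewrite E dotv_suml; apply: (@le_trans _ _ (\sum_(i in K :|: S) c * (3 * d) * t)).
    apply: ler_sum => i iKS; rewrite dotvZl.
    have ai : `|a i| <= c * (3 * d).
      by apply: le_trans (a_le i iKS) _; rewrite ler_wpM2l.
    have [iK|iK] := boolP (i \in K).
      have [iA a_ge0 giz] := KP i iK.
      apply: (@le_trans _ _ (a i * t)); first by rewrite ler_wpM2l // KT.
      by rewrite ler_wpM2r // (le_trans (ler_norm _)).
    have iS : i \in S by move: iKS; rewrite inE (negPf iK).
    by rewrite (le_trans (ler_norm _)) // normrM ler_pM // ST.
  rewrite sumr_const -[leLHS]mulr_natl; apply: ler_wpM2r.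
    by rewrite !mulr_ge0 // ltW.
  by rewrite ler_nat (leq_trans (max_card _)) // card_option card_ord.
rewrite dotvBl dotvZl -dd in sum_le.
have H : d * (d / 2) <= d * (p.+1%:R * (c * 3 * t)).
  by rewrite expr2 in zdot sum_le; lra.
rewrite ler_pM2l // in H.
by lra.
Qed.

End Projection.

(** * Consequences of RCPLD in a neighborhood *)

Section RCPLD_gradients.
Variables (R : realType) (n m p l : nat).
Variables (f : 'rV[R]_n * 'rV[R]_m -> R) (h : 'I_p -> 'rV[R]_n * 'rV[R]_m -> R).
Hypotheses (f_C1 : C1 f) (h_C1 : forall i, C1 (h i)).

Lemma gradS_continuous i :
  continuous (fun z : 'rV[R]_n * 'rV[R]_m => gradS f h z.1 z.2 i).
Proof.
by case: i => [i|] z;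
  [exact: (@grad_y_continuous _ _ _ _ (h_C1 i) z)|exact: (@grad_y_continuous _ _ _ _ f_C1 z)].
Qed.

Lemma RCPLD_good_gradients xb yb : RCPLD l f h xb yb ->
  exists (S : {set option 'I_p}) (c : R), [/\ S \subset Jset p l, 0 < c &
    \forall w \near (xb, yb),
      good_gradients l (None |: Iactive l h xb yb) S c (gradS f h w.1 w.2)].
Proof.
move=> [U [S [nU [SJ [nS [sp [rk cpld]]]]]]].
set Act := None |: _ in cpld *.
have dAct : [disjoint Act & S]%B.
  apply: disjointWr SJ _; rewrite finset.disjoints_subset; apply/fintype.subsetP => i.
  rewrite !inE => /orP[/eqP ->|/imsetP[k + ->]].
    by apply/negP => /imsetP[].
  rewrite inE => /andP[kl _]; apply/negP => /imsetP[k' + [kk']].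
  by rewrite inE -kk' leqNgt kl.
have gc i := @gradS_continuous i (xb, yb).
pose bounded_by c (K : {set option 'I_p}) (w : 'rV[R]_n * 'rV[R]_m) := K \subset Act ->
    forall a : option 'I_p -> R, (forall i, i \in K -> 0 <= a i) ->
    ~ lin_dep (K :|: S) (gradS f h w.1 w.2) ->
    forall i, i \in K :|: S -> `|a i| <= c * `|\sum_(i in K :|: S) a i *: gradS f h w.1 w.2 i|.
have bound K : exists c : R, 0 < c /\ \forall w \near (xb, yb), bounded_by c K w.
  have [KA|KA] := boolP (K \subset Act); last by exists 1; split => //; apply: filterS nU => w _ KA'; case/negP: KA.
  have dKS : [disjoint K & S]%B by apply: disjointWl dAct.
  (* If [K] and [S] are positive-linearly dependent at the reference point, RCPLD makes [K :|: S]
     dependent nearby and the bound is vacuous; otherwise [multiplier_bound] applies. *)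
  have [pd|npd] := pselect (pos_lin_dep K S (gradS f h xb yb)).
    exists 1; split => //; apply: filterS nU => -[x z] Uxz _ a _ /(_ (cpld K KA pd x z Uxz)) [].
  have [|c c0 cP] := @multiplier_bound R _ m p (fun i w => gradS f h w.1 w.2 i) (xb, yb) gc K S.
    move=> a a_ge0 s0 i iKS; apply/eqP/negPn/negP => ai; apply: npd.
    exists a, a; split => //; split; last by rewrite -sum_disjointU.
    by move: iKS; rewrite inE => /orP[iK|iS]; [left|right]; exists i.
  by exists c; split => //; apply: filterS cP => w cw _ a a_ge0 _; exact: cw.
have [c_ cP] := choice bound.
pose c := \sum_(K : {set option 'I_p}) c_ K.
have cK K : c_ K <= c.
  by rewrite /c (bigD1 K) //= lerDl sumr_ge0 // => i _; rewrite ltW //; case: (cP i).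
have c0 : 0 < c by apply: lt_le_trans (cK finset.set0); case: (cP finset.set0).
exists S, c; split => //.
have near_mult : \forall w \near (xb, yb), forall K, bounded_by (c_ K) K w.
  by apply: near_forall => K; case: (cP K).
(* The bound for empty [K] forbids a nontrivial vanishing combination over [S] nearby. *)
have [|c1 c10 near_indep] := @multiplier_bound R _ m p (fun i w => gradS f h w.1 w.2 i)
    (xb, yb) gc finset.set0 S.
  by move=> a _; rewrite finset.set0U; exact: lin_indep_eq0.
have near_nS : \forall w \near (xb, yb), ~ lin_dep S (gradS f h w.1 w.2).
  apply: filterS near_indep => w wP [a [[i [iS ai]] s0]].
  have a_le : `|a i| <= c1 * `|\sum_(i in finset.set0 :|: S) a i *: gradS f h w.1 w.2 i|.
    by apply: wP; rewrite ?finset.set0U // => k; rewrite inE.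
  by move: a_le; rewrite finset.set0U s0 normr0 mulr0 normr_le0 (negPf ai).
apply: filterS (filterI nU (filterI near_mult near_nS)) => w [Uw [mult nSw]].
split; first exact: nSw.
  apply: (@span_of_rank_eq _ _ _ l S SJ (gradS f h xb yb) _ nS nSw sp).
  by move: Uw; rewrite [w]surjective_pairing => /rk.
move=> K a KA a_ge0 nK i iKS.
apply: (@le_trans _ _ (c_ K * `|\sum_(i in K :|: S) a i *: gradS f h w.1 w.2 i|)).
  exact: mult.
by rewrite ler_wpM2r.
Qed.

End RCPLD_gradients.

(** * The error bound *)

Lemma finite_radius (R : realType) (I : finType) (P : I -> R -> Prop) :
  (forall i r r', P i r -> r' <= r -> P i r') ->
  (forall i, exists2 r, 0 < r & P i r) -> exists2 r, 0 < r & forall i, P i r.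
Proof.
move=> mono ex; have ex' i : exists r, 0 < r /\ P i r by case: (ex i) => r; exists r.
have [r_ rP] := choice ex'.
exists (\big[Num.min/1]_i r_ i).
  by elim/big_ind: _ => // [a b a0 b0|i _]; [rewrite lt_min a0|case: (rP i)].
move=> i; apply: mono (rP i).2 _; exact: bigmin_le.
Qed.

Section System.
Variables (R : realType) (n m p l : nat).
Variables (f : 'rV[R]_n * 'rV[R]_m -> R) (h : 'I_p -> 'rV[R]_n * 'rV[R]_m -> R).
Hypotheses (f_C1 : C1 f) (h_C1 : forall i, C1 (h i)).
Variable v : 'rV[R]_n -> R.

Definition fun_of i := match i with None => f | Some k => h k end.

(** The value [v x] is constant along a slice, so differences and gradients in [y] do not see it and
    [v] may be arbitrary. *)
Definition sys i x y := match i with None => f (x, y) - v x | Some k => h k (x, y) end.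

Definition Iset : {set option 'I_p} := [set Some i | i : 'I_p & (i < l)%N]%SET.

(* With [b = true] the system describes the solution map (for [v] the optimal
   value), with [b = false] it describes [Gam]. *)
Definition ineqs (b : bool) : {set option 'I_p} := if b then None |: Iset else Iset.

Definition solset b x : set 'rV[R]_m := feasible (ineqs b) (Jset p l) (fun i => sys i x).

Lemma fun_of_C1 i : C1 (fun_of i).
Proof. by case: i. Qed.

Lemma gradSE x y i : gradS f h x y i = grad_y (fun_of i) x y.
Proof. by case: i. Qed.

Lemma sysB i x y y' : sys i x y - sys i x y' = fun_of i (x, y) - fun_of i (x, y').
Proof. by case: i => //=; rewrite opprB addrA subrK. Qed.

Lemma fun_of_slice_continuous i x : continuous (fun y => fun_of i (x, y)).
Proof.
move=> y; apply: (@continuous_comp _ _ _ (fun y => (x, y)) (fun_of i)).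
  apply: (@cvg_pair _ _ _ (nbhs y) (nbhs x) (nbhs y) _ _ _ (cst x) id (cvg_cst x)).
  exact: cvg_id.
exact: C1_continuous (fun_of_C1 i) _.
Qed.

Lemma sys_continuous i x : continuous (sys i x).
Proof.
case: i => [k|]; first exact: (@fun_of_slice_continuous (Some k) x).
apply: continuous_addr; last exact: cst_continuous.
exact: (@fun_of_slice_continuous None x).
Qed.

Lemma sys_deriv i x z w (t : R) :
  is_derive t 1 (fun s : R => sys i x (z + s *: w)) (dotv (gradS f h x (z + t *: w) i) w).
Proof.
have lineE s : (x, z + s *: w) = (x, z) + s *: (0, w) :> 'rV[R]_n * 'rV[R]_m.
  by congr pair; rewrite /= scaler0 addr0.
have D : is_derive t 1 (fun s : R => fun_of i ((x, z) + s *: (0, w)))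
    (dotv (gradS f h x (z + t *: w) i) w).
  rewrite gradSE -(diff_grad_y (fun_of i)) lineE.
  by apply: is_derive_line; case: (fun_of_C1 i).
case: i D => [k|] D.
  rewrite (_ : (fun s => _) = (fun s : R => fun_of (Some k) ((x, z) + s *: (0, w)))) //.
  by apply/funext => s; rewrite /= lineE.
have D2 := is_deriveB D (is_derive_cst (v x) t (1 : R)).
rewrite subr0 in D2.
rewrite (_ : (fun s => _) = (fun s : R => fun_of None ((x, z) + s *: (0, w))) - cst (v x)) //.
by apply/funext => s; rewrite /= lineE.
Qed.

Lemma mem_ineqs b k : (Some k \in ineqs b) = (k < l)%N.
Proof.
have memI : (Some k \in Iset) = (k < l)%N.
  by apply/imsetP/idP => [[k' + [->]]|kl]; [rewrite inE|exists k; rewrite ?inE].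
by rewrite /ineqs; case: b; rewrite ?finset.in_setU1 memI.
Qed.

Lemma ineqs_disjoint b : [disjoint ineqs b & Jset p l]%B.
Proof.
rewrite finset.disjoints_subset; apply/fintype.subsetP => -[k|] iA; rewrite inE.
  apply/negP => /imsetP[k' + [kk']]; rewrite inE -kk' leqNgt.
  by rewrite mem_ineqs in iA; rewrite iA.
by apply/negP => /imsetP[].
Qed.

Lemma sys_strict_diff xb yb e : 0 < e -> exists2 r, 0 < r & forall i x y y' z,
  `|x - xb| < r -> `|y - yb| < r -> `|y' - yb| < r -> `|z - yb| < r ->
  `|sys i x y - sys i x y' - dotv (gradS f h x z i) (y - y')| <= e * `|y - y'|.
Proof.
move=> e0; apply: (@finite_radius R _ (fun i r => forall x y y' z,
  `|x - xb| < r -> `|y - yb| < r -> `|y' - yb| < r -> `|z - yb| < r ->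
  `|sys i x y - sys i x y' - dotv (gradS f h x z i) (y - y')| <= e * `|y - y'|)).
  move=> i r r' rP rr x y y' z xr yr y'r zr.
  by apply: rP; exact: lt_le_trans rr.
move=> i; have [r r0 rP] := C1_strict_diff (fun_of_C1 i) xb yb e0.
exists r => // x y y' z xr yr y'r zr.
by rewrite sysB gradSE; exact: rP.
Qed.

Lemma fun_of_lipschitz zb : exists L r, [/\ 0 < L, 0 < r & forall i z z',
  `|z - zb| < r -> `|z' - zb| < r -> `|fun_of i z - fun_of i z'| <= L * `|z - z'|].
Proof.
have [|i|r r0 rP] := @finite_radius R _ (fun i r => exists L, 0 < L /\ forall z z',
  `|z - zb| < r -> `|z' - zb| < r -> `|fun_of i z - fun_of i z'| <= L * `|z - z'|).
- move=> i r r' [L [L0 LP]] rr; exists L; split => // z z' zr z'r.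
  by apply: LP; exact: lt_le_trans rr.
- by have [L [r [L0 r0 LP]]] := C1_lipschitz (fun_of_C1 i) zb; exists r => //; exists L.
have [L_ LP] := choice rP; exists (\sum_i L_ i), r.
have L_le i : L_ i <= \sum_i L_ i.
  by rewrite (bigD1 i) //= lerDl sumr_ge0 // => j _; rewrite ltW //; case: (LP j).
split => //; first by apply: lt_le_trans (L_le None); case: (LP None).
move=> i z z' zr z'r; have [_ H] := LP i.
by apply: le_trans (H _ _ zr z'r) _; rewrite ler_wpM2r.
Qed.

Lemma sys_near_active b xb q0 : Gam l h xb q0 ->
  \forall w \near (xb, q0), forall i, i \in ineqs b -> 0 < sys i w.1 w.2 ->
    i \in None |: Iactive l h xb q0.
Proof.
move=> [hI _]; apply: near_forall => -[k|]; last by near=> w => _ _; rewrite !inE.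
have [kA|kA] := boolP (Some k \in Iactive l h xb q0).
  by near=> w => _ _; rewrite inE kA orbT.
have [kl|kl] := ltnP k l; last by near=> w; rewrite mem_ineqs ltnNge kl.
have hk : h k (xb, q0) < 0.
  rewrite lt_def hI // andbT eq_sym; apply: contraNN kA => hk0.
  by apply/imsetP; exists k => //; rewrite inE kl.
have near_neg : \forall w \near (xb, q0), h k w < 0.
  by have /cvgr_lt := @C1_continuous _ _ _ _ (h_C1 k) (xb, q0); apply.
apply: filterS near_neg => -[x y] /= hw _ hw'.
by move: (lt_trans hw hw'); rewrite ltxx.
Unshelve. all: by end_near.
Qed.

(** Only [x] and the projection [q] are localized; [y] is arbitrary, which the convex case
    exploits. *)
Lemma local_projection_bound b xb q0 : Gam l h xb q0 -> RCPLD l f h xb q0 ->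
  exists (S : {set option 'I_p}) C r, [/\ S \subset Jset p l, 0 < C, 0 < r &
  forall x y q eta, `|x - xb| < r -> `|q - q0| < r -> solset b x q ->
    (forall w, solset b x w -> enorm (q - y) <= enorm (w - y)) ->
    0 < eta -> eta <= r -> enorm (q - y) != 0 -> eta <= enorm (q - y) / (4 * m.+1%:R) ->
    exists2 z, enorm (z - q) < eta & forall t, 0 <= t ->
      (forall i, i \in ineqs b -> 0 < sys i x z -> dotv (gradS f h x z i) (y - q) <= t) ->
      (forall j, j \in S -> `|dotv (gradS f h x z j) (y - q)| <= t) ->
      enorm (q - y) <= C * t].
Proof.
move=> Gq0 /(RCPLD_good_gradients f_C1 h_C1) [S [c [SJ c0 near_good]]].
have nbG : nbhs (xb, q0) [set w | good_gradients l (None |: Iactive l h xb q0) S c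
    (gradS f h w.1 w.2) /\ forall i, i \in ineqs b -> 0 < sys i w.1 w.2 ->
    i \in None |: Iactive l h xb q0].
  by apply: filterI near_good _; exact: sys_near_active.
have /nbhs_ballP [r /= r0 rP] := nbG.
(* Half the radius, because [z] is within [eta] of [q]. *)
exists S, (6 * p.+1%:R * c), (r / 2); split; [exact: SJ|by rewrite !mulr_gt0|exact: divr_gt0|].
move=> x y q eta xr qr solq qmin eta0 eta_r d0 eta_d.
apply: (@projection_estimate R m p l (ineqs b) (None |: Iactive l h xb q0) S c
  (fun i => sys i x) (fun i z => gradS f h x z i)) => //.
- by move=> i; exact: sys_continuous.
- by move=> i z w t; exact: sys_deriv.
- exact: ineqs_disjoint.
- exact: ltW.
move=> z zq; apply: (rP (x, z)); split; rewrite -ball_normE /= distrC.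
  by move: xr r0; lra.
rewrite -[z](subrK q) -addrA (le_lt_trans (ler_normD _ _)) //.
have := le_lt_trans (norm_le_enorm (z - q)) zq.
by move: qr eta_r; lra.
Qed.

Lemma solset_closed b x : closed (solset b x).
Proof. by apply: feasible_closed => i; exact: sys_continuous. Qed.

(** The pairings in the projection bound are replaced by differences of [sys] between [y] and [q].
    All errors sum to half of the distance [d] and are absorbed on the left, whence the factor 2 in
    [kappa]. *)
Lemma error_bound b xb yb : Gam l h xb yb -> RCPLD l f h xb yb ->
  (forall e, 0 < e -> \forall x \near xb, exists2 s, solset b x s & `|s - yb| < e) ->
  exists kappa r, [/\ 0 < kappa, 0 < r & forall x y rho,
    `|x - xb| < r -> `|y - yb| < r -> 0 <= rho ->
    (forall i, i \in ineqs b -> sys i x y <= rho) ->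
    (forall j, j \in Jset p l -> `|sys j x y| <= rho) ->
    exists2 s, solset b x s & enorm (s - y) <= kappa * rho].
Proof.
move=> Gyb cq isc; have [S [C [r1 [SJ C0 r10 est]]]] := local_projection_bound b Gyb cq.
have e0 : 0 < (4 * C)^-1 by rewrite invr_gt0 mulr_gt0.
have [r2 r20 sdiff] := sys_strict_diff xb yb e0.
have [L [r3 [L0 r30 lip]]] := fun_of_lipschitz (xb, yb).
pose r := Num.min r1 (Num.min r2 r3).
have r0 : 0 < r by rewrite !lt_min r10 r20 r30.
have [rr1 rr2 rr3] : [/\ r <= r1, r <= r2 & r <= r3].
  by rewrite /r !ge_min !lexx !orbT.
have m1 : 1 <= m.+1%:R :> R by rewrite ler1n.
have m0 : 0 < m.+1%:R :> R by rewrite ltr0n.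
pose r' := r / (4 * m.+1%:R).
have r'0 : 0 < r' by rewrite divr_gt0 // mulr_gt0.
have r'E : m.+1%:R * r' = r / 4 by rewrite /r'; field; rewrite gt_eqF.
have r'r : r' <= r / 4 by rewrite -r'E ler_peMl // ltW.
have /nbhs_ballP [rx /= rx0 rxP] := isc _ r'0.
exists (2 * C), (Num.min rx r'); split; [by rewrite mulr_gt0|by rewrite lt_min rx0|].
move=> x y rho; rewrite !lt_min => /andP[xrx xr'] /andP[_ yr'] rho0 hA hJ.
have [s ss sr'] : exists2 s, solset b x s & `|s - yb| < r'.
  by apply: rxP; rewrite -ball_normE /= distrC.
have [q solq qmin] := nearest_point y (ex_intro _ s ss) (@solset_closed b x).
exists q => //; set d := enorm (q - y).
have [d0|d_neq0] := eqVneq d 0; first by rewrite d0 !mulr_ge0 // ltW.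
have dpos : 0 < d by rewrite lt_def d_neq0 enorm_ge0.
have qy : `|q - y| <= d by exact: norm_le_enorm.
(* The nearby solution [s] bounds the distance from [y], which forces the projection to stay near
   [yb]. *)
have dr : d <= r / 2.
  apply: le_trans (qmin _ ss) _; apply: le_trans (enorm_le_norm _) _.
  have sy : `|s - y| <= 2 * r'.
    rewrite -(subrKA yb) (le_trans (ler_normD _ _)) //.
    by move: sr' yr'; rewrite (distrC yb); clear; lra.
  apply: (@le_trans _ _ (m.+1%:R * (2 * r'))); last by rewrite mulrCA r'E; lra.
  by apply: ler_pM; rewrite ?ler_nat.
have qr : `|q - yb| < r.
  rewrite -(subrKA y) (le_lt_trans (ler_normD _ _)) //.
  by move: qy dr yr' r'r r0; clear; lra.
have yr : `|y - yb| < r by move: yr' r'r r0; clear; lra.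
have xr : `|x - xb| < r by move: xr' r'r r0; clear; lra.
(* Three demands: [z] stays in the neighborhood, the smallness required by the estimate, and a
   change of [sys] of at most [D] between [q] and [z]. *)
pose eta := Num.min (r / 4) (Num.min (d / (4 * m.+1%:R)) (d / (4 * C * L))).
have eta0 : 0 < eta by rewrite !lt_min !divr_gt0 ?mulr_gt0.
have [er [ed eL]] : eta <= r / 4 /\ eta <= d / (4 * m.+1%:R) /\ eta <= d / (4 * C * L).
  by rewrite /eta !ge_min !lexx !orbT.
have er1 : eta <= r1 by move: er rr1 r0; lra.
have [z zq zP] := est x y q eta (lt_le_trans xr rr1) (lt_le_trans qr rr1) solq qmin
  eta0 er1 d_neq0 ed.
have zr : `|z - yb| < r.
  rewrite -(subrKA q) (le_lt_trans (ler_normD _ _)) //.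
  have zq' := le_lt_trans (norm_le_enorm (z - q)) zq.
  have qyb : `|q - yb| <= `|q - y| + `|y - yb|.
    by rewrite -[q - yb](subrKA y) ler_normD.
  by move: zq' qyb er qy dr yr' r'r; clear; lra.
pose D := d / (4 * C).
have L_eta : L * eta <= D.
  have -> : D = L * (d / (4 * C * L)) by rewrite /D; field; rewrite !gt_eqF.
  by rewrite ler_pM2l.
have yqD : (4 * C)^-1 * `|y - q| <= D.
  by rewrite /D mulrC distrC ler_wpM2r // ltW.
have D0 : 0 <= D by rewrite ltW // divr_gt0 // mulr_gt0.
have sd i := sdiff i x y q z (lt_le_trans xr rr2) (lt_le_trans yr rr2)
  (lt_le_trans qr rr2) (lt_le_trans zr rr2).
have dist_pair (u w : 'rV[R]_m) c : `|x - xb| < c -> `|u - w| < c -> `|(x, u) - (xb, w)| < c.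
  by move=> xc uc; rewrite prod_normE gt_max xc.
have zqL i : `|sys i x z - sys i x q| <= D.
  apply: le_trans L_eta; rewrite sysB; apply: le_trans (lip i _ _ _ _) _.
  - exact: dist_pair (lt_le_trans xr rr3) (lt_le_trans zr rr3).
  - exact: dist_pair (lt_le_trans xr rr3) (lt_le_trans qr rr3).
  rewrite ler_pM2l // prod_normE /= subrr normr0 ge_max (ltW eta0) /=.
  exact: le_trans (norm_le_enorm _) (ltW zq).
have : d <= C * (rho + 2 * D).
  (* An inequality violated at [z] is at least [- D] at [q], so its increase from [q] to [y] is at
     most [rho + D]; linearization costs another [D]. *)
  apply: zP => [|i iA zi|j jS]; first by move: rho0 D0; lra.
    have := le_trans (sd i) yqD; have := zqL i; have := hA i iA.
    by rewrite !ler_norml => H1 /andP[H2 H3] /andP[H4 H5]; move: H1 H2 H3 H4 H5 zi; lra.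
  have jJ : j \in Jset p l by move/fintype.subsetP: SJ; apply.
  have := le_trans (sd j) yqD; have := hJ j jJ; rewrite (solq.2 j jJ) subr0.
  by rewrite !ler_norml => /andP[H2 H3] /andP[H4 H5]; move: H2 H3 H4 H5 D0; lra.
have -> : C * (rho + 2 * D) = C * rho + d / 2 by rewrite /D; field; rewrite gt_eqF.
by lra.
Qed.

End System.

(** * Regularity of the solution map *)

Section Solution_map.
Variables (R : realType) (n m p l : nat).
Variables (f : 'rV[R]_n * 'rV[R]_m -> R) (h : 'I_p -> 'rV[R]_n * 'rV[R]_m -> R).
Hypotheses (f_C1 : C1 f) (h_C1 : forall i, C1 (h i)).

(** [fine] sends infinite values to 0; [optval] is the true value wherever [phi] is finite, in
    particular where solutions exist. *)
Definition optval x : R := fine (phi l f h x).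

Definition isc_at (xb : 'rV[R]_n) (yb : 'rV[R]_m) := forall e : R, 0 < e ->
  \forall x \near xb, exists2 s, Ssol l f h x s & `|s - yb| < e.

Lemma phi_Ssol x s : Ssol l f h x s -> phi l f h x = (f (x, s))%:E.
Proof.
move=> [Gs smin]; apply/eqP; rewrite eq_le; apply/andP; split.
  by apply: ereal_inf_lbound; exists s.
by apply: le_ereal_inf_tmp => _ [z Gz <-]; rewrite lee_fin smin.
Qed.

Lemma optval_Ssol x s : Ssol l f h x s -> optval x = f (x, s).
Proof. by move=> /phi_Ssol; rewrite /optval => ->. Qed.

Lemma solsetP b x y : solset l f h optval b x y <-> Gam l h x y /\ (b -> f (x, y) <= optval x).
Proof.
split => [[hA hJ]|[[hI hJ] hb]].
  split; first split.
  - by move=> i il; apply: (hA (Some i)); rewrite mem_ineqs.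
  - by move=> i li; apply: (hJ (Some i)); apply/imsetP; exists i; rewrite ?inE.
  - case: b hA => // hA _; have := hA None; rewrite /= subr_le0; apply.
    by rewrite finset.in_setU1 eqxx.
split => [[k|] iA|_ /imsetP[k + ->]].
- by apply: hI; rewrite mem_ineqs in iA.
- case: b hb iA => [hb _|_]; first by rewrite subr_le0 hb.
  by move=> /imsetP[].
- by rewrite inE => lk; apply: hJ.
Qed.

(** The solution [s] ensures that [optval x] is the attained minimum and not a default value. *)
Lemma solset_Ssol x s y : Ssol l f h x s -> solset l f h optval true x y <-> Ssol l f h x y.
Proof.
move=> Ss; rewrite solsetP (optval_Ssol Ss); split => [[Gy /(_ isT) fy]|[Gy ymin]].
  by split => // z Gz; rewrite (le_trans fy) //; case: Ss => _; apply.
by split => // _; apply: ymin; case: Ss.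
Qed.

Lemma isc_solset b xb yb : isc_at xb yb ->
  forall e, 0 < e -> \forall x \near xb, exists2 s, solset l f h optval b x s & `|s - yb| < e.
Proof.
move=> isc e e0; apply: filterS (isc e e0) => x [s Ss se]; exists s => //.
by apply/solsetP; split; [case: Ss|move=> _; rewrite (optval_Ssol Ss)].
Qed.

Lemma isc_Rregular xb yb : Ssol l f h xb yb -> isc_at xb yb -> RCPLD l f h xb yb ->
  Rregular l f h xb yb.
Proof.
move=> Sb isc cq.
have [kappa [r [k0 r0 eb]]] := error_bound f_C1 h_C1 Sb.1 cq (@isc_solset true _ _ isc).
have /nbhs_ballP[rx /= rx0 rxP] := isc _ (ltr01 : 0 < 1 :> R).
exists kappa, (ball (xb, yb) (Num.min r rx)); split => //; split.
  by apply: nbhsx_ballx; rewrite lt_min r0.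
move=> x y [/= xr yr].
move: xr yr; rewrite -!ball_normE /= !lt_min !(distrC _ x) !(distrC _ y) => /andP[xr xrx] /andP[yr _].
have [s0 Ss0 _] : exists2 s, Ssol l f h x s & `|s - yb| < 1.
  by apply: rxP; rewrite -ball_normE /= distrC.
have res_h0 : ((f (x, y) - optval x)%:E <= resid l f h x y)%E.
  by rewrite /resid le_max /h0 (phi_Ssol Ss0) (optval_Ssol Ss0) -EFinB lexx.
have res0 : (0 <= resid l f h x y)%E by rewrite /resid le_max bigmax_ge_id orbT.
have res_h (i : 'I_p) : ((if (i < l)%N then (h i (x, y))%:E else (`|h i (x, y)|)%:E) <= resid l f h x y)%E.
  by rewrite /resid le_max (le_bigmax _ (fun i : 'I_p => if (i < l)%N then (h i (x, y))%:E
    else (`|h i (x, y)|)%:E) i) orbT.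
(* An infinite residual makes the claim trivial; a finite one serves as [rho]. *)
case: (resid l f h x y) res_h0 res0 res_h => [rho| |] // res_h0 res0 res_h; last first.
  by rewrite gt0_muley ?lte_fin // leey.
have [|[k|] kA|j /imsetP[k + ->]|s ss se] := eb x y rho xr yr.
- by rewrite -lee_fin.
- by have := res_h k; rewrite mem_ineqs in kA; rewrite kA lee_fin.
- by rewrite -lee_fin.
- by rewrite inE => lk; have := res_h k; rewrite ltnNge lk lee_fin.
apply: (@le_trans _ _ (enorm (s - y))%:E); last by rewrite -EFinM lee_fin.
by apply: ereal_inf_lbound; exists s => //; apply/(solset_Ssol _ Ss0).
Qed.

(** The error bound for [Gam] first yields the Lipschitz estimate [val_lip] for the optimal value.
    Then a solution at [x] has residual of order [|x - x'|] at [x'], and the error bound for [Ssol]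
    applies. *)
Lemma isc_Aubin xb yb : Ssol l f h xb yb -> isc_at xb yb -> RCPLD l f h xb yb ->
  Aubin l f h xb yb.
Proof.
move=> Sb isc cq.
have [k1 [r1 [k10 r10 eb1]]] := error_bound f_C1 h_C1 Sb.1 cq (@isc_solset true _ _ isc).
have [k2 [r2 [k20 r20 eb2]]] := error_bound f_C1 h_C1 Sb.1 cq (@isc_solset false _ _ isc).
have [L [r3 [L0 r30 lip]]] := @fun_of_lipschitz _ _ _ _ f h f_C1 h_C1 (xb, yb).
pose e := Num.min r2 (r3 / 2).
have e0 : 0 < e by rewrite lt_min r20 divr_gt0.
have /nbhs_ballP[rx /= rx0 rxP] := isc e e0.
(* For [x], [x'] within [r5] of [xb], the feasible point found near [s'] is at most [r3 / 2] away
   from it. *)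
pose r5 := r3 / (4 * (k2 * L)).
have r50 : 0 < r5 by rewrite divr_gt0 // !mulr_gt0.
pose rV := Num.min (Num.min r1 r2) (Num.min r3 (Num.min rx r5)).
have rV0 : 0 < rV by rewrite !lt_min r10 r20 r30 rx0 r50.
have dist_pair (x : 'rV[R]_n) (u : 'rV[R]_m) c :
    `|x - xb| < c -> `|u - yb| < c -> `|(x, u) - (xb, yb)| < c.
  by move=> xc uc; rewrite prod_normE gt_max xc.
have lipx i x x' u : `|x - xb| < r3 -> `|x' - xb| < r3 -> `|u - yb| < r3 ->
    `|fun_of f h i (x, u) - fun_of f h i (x', u)| <= L * `|x - x'|.
  move=> xr xr' ur; apply: le_trans (lip i _ _ (dist_pair _ _ _ xr ur) (dist_pair _ _ _ xr' ur)) _.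
  by rewrite ler_pM2l // prod_normE /= subrr normr0 ge_max lexx normr_ge0.
have VP x : `|x - xb| < rV -> [/\ `|x - xb| < r1, `|x - xb| < r2, `|x - xb| < r3,
    `|x - xb| < r5 & exists2 s, Ssol l f h x s & `|s - yb| < e].
  rewrite !lt_min => /andP[/andP[? ?] /andP[? /andP[? ?]]]; split => //.
  by apply: rxP; rewrite -ball_normE /= distrC.
pose M := L * (1 + k2 * L).
have val_lip x x' : `|x - xb| < rV -> `|x' - xb| < rV -> optval x <= optval x' + M * `|x - x'|.
  move=> /VP[_ x2 x3 x5 [s Ss _]] /VP[_ _ x'3 x'5 [s' Ss' s'e]].
  have [s'2 s'3] : `|s' - yb| < r2 /\ `|s' - yb| < r3 / 2.
    by move: s'e; rewrite lt_min => /andP.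
  have s'3' : `|s' - yb| < r3 by move: s'3 r30; lra.
  (* The solution [s'] at [x'] is nearly feasible at [x]; the feasible [w] close to it bounds the
     optimal value at [x] from above. *)
  have [|[k|] kA|j /imsetP[k + ->]|w sw we] := eb2 x s' (L * `|x - x'|) x2 s'2.
  - by rewrite mulr_ge0 // ltW.
  - have := lipx (Some k) x x' s' x3 x'3 s'3'; rewrite ler_norml => /andP[_].
    rewrite mem_ineqs in kA; have [[hI _] _] := Ss'; have := hI k kA.
    by rewrite /=; lra.
  - by move: kA => /imsetP[].
  - rewrite inE => lk; have := lipx (Some k) x x' s' x3 x'3 s'3'.
    by have [[_ hJ] _] := Ss'; rewrite /= (hJ k lk) subr0.
  have [Gw _] := (solsetP false x w).1 sw.
  have ws' : `|w - s'| <= k2 * L * `|x - x'|.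
    by rewrite -mulrA (le_trans (norm_le_enorm _)).
  have xx' : k2 * L * `|x - x'| <= r3 / 2.
    have -> : r3 / 2 = k2 * L * (r5 + r5) by rewrite /r5; field; rewrite !gt_eqF.
    rewrite ler_pM2l ?mulr_gt0 // -(subrKA xb) (le_trans (ler_normD _ _)) //.
    by rewrite lerD // ltW // distrC.
  have w3 : `|w - yb| < r3.
    rewrite -(subrKA s') (le_lt_trans (ler_normD _ _)) //.
    by move: ws' xx' s'3; lra.
  have fw : f (x, w) - f (x', s') <= M * `|x - x'|.
    apply: le_trans (ler_norm _) _.
    apply: le_trans (lip None _ _ (dist_pair _ _ _ x3 w3) (dist_pair _ _ _ x'3 s'3')) _.
    rewrite /M -mulrA ler_pM2l // prod_normE /= ge_max.
    by apply/andP; split; rewrite mulrDl mul1r; [rewrite lerDl !mulr_ge0 // ltW|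
       rewrite (le_trans ws') // lerDr].
  rewrite (optval_Ssol Ss) (optval_Ssol Ss').
  by have := Ss.2 w Gw; move: fw; lra.
have M0 : 0 < M by rewrite mulr_gt0 // addr_gt0 // mulr_gt0.
exists (ball xb rV), (ball yb (Num.min r1 r3)), (k1 * (L + M)).
split; first exact: nbhsx_ballx.
split; first by apply: nbhsx_ballx; rewrite lt_min r10.
split; first by rewrite mulr_gt0 // addr_gt0.
move=> x x'; rewrite -!ball_normE /= !(distrC xb) => xV xV' y Sy.
rewrite (distrC yb) lt_min => /andP[y1 y3].
have [_ _ x3 _ _] := VP x xV; have [x'1 _ x'3 _ [s' Ss' _]] := VP x' xV'.
have Lx i : `|fun_of f h i (x', y) - fun_of f h i (x, y)| <= L * `|x - x'|.
  by rewrite [`|x - x'|]distrC; exact: lipx.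
have MLx : L * `|x - x'| <= (L + M) * `|x - x'|.
  by rewrite mulrDl lerDl mulr_ge0 // ltW.
have [|[k|] kA|j /imsetP[k + ->]|s ss se] := eb1 x' y ((L + M) * `|x - x'|) x'1 y1.
- by rewrite mulr_ge0 // addr_ge0 // ltW.
- apply: le_trans MLx; have := Lx (Some k); rewrite ler_norml => /andP[_].
  rewrite mem_ineqs in kA; have [[hI _] _] := Sy; have := hI k kA.
  by rewrite /=; lra.
- have := Lx None; rewrite ler_norml => /andP[_]; have := val_lip x x' xV xV'.
  by rewrite (optval_Ssol Sy) /= mulrDl; lra.
- rewrite inE => lk; apply: le_trans MLx; have := Lx (Some k).
  by have [[_ hJ] _] := Sy; rewrite /= (hJ k lk) subr0.
exists s; split; first exact/(solset_Ssol _ Ss').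
rewrite enormB (le_trans se) // -!mulrA ler_pM2l // ler_pM2l ?addr_gt0 //.
exact: norm_le_enorm.
Qed.

(** If the uniform form fails, points without nearby solutions chosen in balls of radius
    [k.+1%:R^-1] form a sequence contradicting [inner_sc]. *)
Lemma inner_sc_isc xb yb : inner_sc l f h xb yb -> isc_at xb yb.
Proof.
move=> isc e e0; apply: contrapT => nnear.
have bad k : exists x, ball xb k.+1%:R^-1 x /\ ~ (exists2 s, Ssol l f h x s & `|s - yb| < e).
  apply: contrapT => nex; apply: nnear; apply/nbhs_ballP.
  exists k.+1%:R^-1 => /=; first by rewrite invr_gt0 ltr0n.
  by move=> x xk; apply: contrapT => nS; apply: nex; exists x.
have [xk xkP] := choice bad.
have [|yk [yk_cvg ykS]] := isc xk.
  apply/cvgrPdist_lt => d d0.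
  have := near_infty_natSinv_lt (PosNum d0); apply: filterS => k /= kd.
  by have [+ _] := xkP k; rewrite -ball_normE /= => /lt_trans; apply.
have near_yk : \forall k \near \oo, `|yb - yk k| < e.
  by have /cvgrPdist_lt/(_ _ e0) := yk_cvg.
have [k [yke Sk]] : exists k, `|yb - yk k| < e /\ Ssol l f h (xk k) (yk k).
  have [k [a b]] := filter_ex (filterI near_yk ykS).
  by exists k.
by have [_] := xkP k; apply; exists (yk k) => //; rewrite distrC.
Qed.

End Solution_map.

(** * The convex case *)

(** For steps in [(0, 1]] convexity bounds the difference quotient by [g w - g z]; a larger limit
    [D] would violate this at a small step. *)
Lemma convex_grad (R : realType) (m : nat) (g : 'rV[R]_m -> R) (z w : 'rV[R]_m) (D : R) :
  convex_in g -> is_derive (0 : R) (1 : R) (fun s : R => g (z + s *: (w - z))) D ->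
  D <= g w - g z.
Proof.
move=> cg [dq Dq]; rewrite leNgt; apply/negP => wD.
have := dq; rewrite /derivable => /cvg_ex [D' cD].
have D'E : D' = D.
  by rewrite -Dq /derive; apply/esym/cvg_lim => //; exact: cD.
have : \forall s \near (0 : R)^', g w - g z < s^-1 *: (g (z + s *: (w - z)) - g z).
  have /cvgr_gt H := cD; rewrite -D'E in wD.
  apply: filterS (H _ wD) => s /=.
  by rewrite addr0 scale0r addr0 [s *: 1]mulr1.
rewrite /dnbhs /within /= => /nbhs_ballP[r /= r0 rP].
pose s := Num.min (r / 2) 1.
have s0 : 0 < s by rewrite lt_min ltr01 divr_gt0.
have [s1 sr] : s <= 1 /\ s <= r / 2 by rewrite /s !ge_min !lexx orbT.
have := rP s; rewrite -ball_normE /= sub0r normrN gtr0_norm // gt_eqF // => H.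
have {H} : g w - g z < s^-1 *: (g (z + s *: (w - z)) - g z).
  by apply: H => //; move: sr r0; lra.
apply/negP; rewrite -leNgt [_ *: _]mulrC ler_pdivrMr //.
have -> : z + s *: (w - z) = s *: w + (1 - s) *: z.
  by rewrite scalerBr scalerBl scale1r addrCA addrA.
by have := cg w z s (ltW s0) s1; lra.
Qed.

Section Convex_case.
Variables (R : realType) (n m p l : nat).
Variables (f : 'rV[R]_n * 'rV[R]_m -> R) (h : 'I_p -> 'rV[R]_n * 'rV[R]_m -> R).
Hypotheses (f_C1 : C1 f) (h_C1 : forall i, C1 (h i)).
Hypothesis f_convex : forall x, convex_in (fun y => f (x, y)).
Hypothesis h_convex : forall x (i : 'I_p), (i < l)%N -> convex_in (fun y => h i (x, y)).
Hypothesis h_affine : forall x (i : 'I_p), (l <= i)%N -> affine_in (fun y => h i (x, y)).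

Lemma affine_combination (g : 'rV[R]_m -> R) y z t : affine_in g ->
  g (t *: y + (1 - t) *: z) = t * g y + (1 - t) * g z.
Proof.
move=> [a [b gE]]; rewrite !gE.
have -> : \sum_(j < m) a 0 j * (t *: y + (1 - t) *: z) 0 j =
    t * \sum_(j < m) a 0 j * y 0 j + (1 - t) * \sum_(j < m) a 0 j * z 0 j.
  by rewrite !mulr_sumr -big_split; apply: eq_bigr => j _; rewrite !mxE /=; ring.
by ring.
Qed.

Variable v : 'rV[R]_n -> R.

Lemma sys_convex b i x : i \in ineqs p l b -> convex_in (sys f h v i x).
Proof.
case: i => [k|] iA y z t t0 t1.
  by apply: h_convex => //; rewrite mem_ineqs in iA.
by have := @f_convex x y z t t0 t1; rewrite /=; lra.
Qed.

Lemma sys_convex_grad b i x y z : i \in ineqs p l b ->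
  dotv (gradS f h x z i) (y - z) <= sys f h v i x y - sys f h v i x z.
Proof.
move=> iA; apply: (convex_grad (sys_convex x iA)).
by have := sys_deriv f_C1 h_C1 v i x z (y - z) 0; rewrite scale0r addr0.
Qed.

(** The gradient inequality for convex functions is applied to the function and to its negative. *)
Lemma sys_affine_grad j x y z : j \in Jset p l ->
  dotv (gradS f h x z j) (y - z) = sys f h v j x y - sys f h v j x z.
Proof.
move=> jJ; have D := sys_deriv f_C1 h_C1 v j x z (y - z) 0.
rewrite scale0r addr0 in D.
have aff : affine_in (sys f h v j x).
  by move/imsetP: jJ => [k + ->]; rewrite inE => lk; exact: h_affine.
apply/eqP; rewrite eq_le; apply/andP; split.
  by apply: convex_grad D => u w t t0 t1; rewrite (affine_combination _ _ _ aff).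
have cN : convex_in (fun u => - sys f h v j x u).
  by move=> u w t t0 t1; rewrite (affine_combination _ _ _ aff); lra.
have DN : is_derive (0 : R) (1 : R) (fun s : R => - sys f h v j x (z + s *: (y - z)))
    (- dotv (gradS f h x z j) (y - z)) := is_deriveN D.
by have := convex_grad cN DN; lra.
Qed.

End Convex_case.

(** * Inner semicontinuity from convexity and compactness *)

Section Convex_isc.
Variables (R : realType) (n m p l : nat).
Variables (f : 'rV[R]_n * 'rV[R]_m -> R) (h : 'I_p -> 'rV[R]_n * 'rV[R]_m -> R).
Hypotheses (f_C1 : C1 f) (h_C1 : forall i, C1 (h i)).
Hypothesis f_convex : forall x, convex_in (fun y => f (x, y)).
Hypothesis h_convex : forall x (i : 'I_p), (i < l)%N -> convex_in (fun y => h i (x, y)).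
Hypothesis h_affine : forall x (i : 'I_p), (l <= i)%N -> affine_in (fun y => h i (x, y)).
Variables (xb : 'rV[R]_n) (yb : 'rV[R]_m).
Hypothesis Sb : Ssol l f h xb yb.
Hypothesis phi_cont : phi l f h x @[x --> xb] --> phi l f h xb.

Local Notation v := (optval l f h).

Lemma optval_continuous : v x @[x --> xb] --> v xb.
Proof.
have := phi_cont; rewrite (phi_Ssol Sb) => /fine_cvg.
by rewrite -(optval_Ssol Sb).
Qed.

Lemma phi_near_fin_num : \forall x \near xb, phi l f h x \is a fin_num.
Proof. by have := phi_cont; rewrite (phi_Ssol Sb) => /fine_cvgP[]. Qed.

Lemma near_Ssol_nonempty M : (\forall x \near xb, forall y, Gam l h x y -> enorm y <= M) ->
  \forall x \near xb, Ssol l f h x !=set0.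
Proof.
move=> nearM; apply: filterS (filterI nearM phi_near_fin_num) => x [GM fin].
have GamE : Gam l h x = solset l f h v false x.
  by apply/seteqP; split => y /=; rewrite solsetP; [move=> G; split|case].
have [||||s Gs smin] := @EVT_min_closed R m (fun y => f (x, y)) (Gam l h x) 0 M.
(* An empty feasible set would have infinite infimum, against finiteness of [phi] near [xb]. *)
- apply/set0P/eqP => G0; move: fin; rewrite /phi G0 image_set0 ereal_inf0.
  by [].
- by rewrite GamE; exact: solset_closed.
- by move=> w /GM; rewrite subr0.
- exact: (@fun_of_slice_continuous _ _ _ _ f h f_C1 h_C1 None x).
by exists s.
Qed.

Lemma sys_slice_continuous i : sys f h v i x yb @[x --> xb] --> sys f h v i xb yb.
Proof.
have slice j : fun_of f h j (x, yb) @[x --> xb] --> fun_of f h j (xb, yb).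
  apply: (@continuous_comp _ _ _ (fun x => (x, yb)) (fun_of f h j)).
    apply: (@cvg_pair _ _ _ (nbhs xb) (nbhs xb) (nbhs yb) _ _ _ id (cst yb)).
      exact: cvg_id.
    exact: cvg_cst.
  by apply: C1_continuous; exact: fun_of_C1.
case: i => [k|]; first exact: (slice (Some k)).
exact: (cvgB (slice None) optval_continuous).
Qed.

Lemma near_residual rho : 0 < rho -> \forall x \near xb, forall i,
  (i \in ineqs p l true -> sys f h v i x yb <= rho) /\
  (i \in Jset p l -> `|sys f h v i x yb| <= rho).
Proof.
move=> rho0; have Sxb : solset l f h v true xb yb by apply/(solset_Ssol _ Sb).
apply: near_forall => i.
have /cvgrPdist_lt/(_ _ rho0) near_i := @sys_slice_continuous i.
apply: filterS near_i => x near_x; split => iA.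
  have := Sxb.1 i iA; move: near_x; rewrite ltr_norml => /andP[+ _].
  by lra.
by move: near_x; rewrite (Sxb.2 i iA) sub0r normrN => /ltW.
Qed.

(** Closedness of the graph over [xb]: being suboptimal, violating an inequality and violating an
    equality are each stable under small perturbations, the first by continuity of the optimal
    value. *)
Lemma not_Ssol_near q0 : ~ Ssol l f h xb q0 ->
  \forall w \near (xb, q0), ~ Ssol l f h w.1 w.2.
Proof.
move=> nS; have hc k := @C1_continuous _ _ _ (h k) (h_C1 k) (xb, q0).
have [G|nG] := pselect (Gam l h xb q0).
  have fq : 0 < f (xb, q0) - v xb.
    rewrite subr_gt0 (optval_Ssol Sb) ltNge; apply/negP => fle; apply: nS.
    by split => // z Gz; apply: le_trans fle _; apply: Sb.2.
  have gc : f w - v w.1 @[w --> (xb, q0)] --> f (xb, q0) - v xb.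
    apply: cvgB; first exact: (@C1_continuous _ _ _ f f_C1 (xb, q0)).
    by apply: (cvg_comp _ _ (@cvg_fst _ _ (nbhs xb) (nbhs q0) _)); exact: optval_continuous.
  have /cvgr_gt/(_ _ fq) near_gt := gc.
  apply: filterS near_gt => -[x q] /= fx Sq.
  by move: fx; rewrite (optval_Ssol Sq) subrr ltxx.
have [[k [kl hk]]|nI] := pselect (exists k : 'I_p, (k < l)%N /\ 0 < h k (xb, q0)).
  have /cvgr_gt/(_ _ hk) near_gt := hc k.
  apply: filterS near_gt => -[x q] /= hx [[hI _] _].
  by have := lt_le_trans hx (hI k kl); rewrite ltxx.
have [[k [lk hk]]|nJ] := pselect (exists k : 'I_p, (l <= k)%N /\ h k (xb, q0) != 0).
  have /cvgr_neq0/(_ hk) near_neq := hc k.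
  apply: filterS near_neq => -[x q] /= hx [[_ hJ] _].
  by move: hx; rewrite hJ ?eqxx.
case: nG; split => k kl.
  by rewrite leNgt; apply/negP => hk; apply: nI; exists k.
by apply/eqP/negPn/negP => hk; apply: nJ; exists k.
Qed.

(* By convexity, the estimate is global in the first argument of the projection:
   [yb] need not be close to [q]. *)
Definition near_solution e x q := Ssol l f h x q ->
  (forall w, Ssol l f h x w -> enorm (q - yb) <= enorm (w - yb)) -> enorm (q - yb) < e.

(** If the projection of [yb] were at distance at least [e], the projection bound would give at most
    [3 / 4 * e]. The gradient inequality compares [yb] with [z] directly, and the residual of [yb]
    at [x] is small by continuity. *)
Lemma near_solution_at e q0 : 0 < e -> Ssol l f h xb q0 -> RCPLD l f h xb q0 ->
  exists2 r, 0 < r & forall x q, `|x - xb| < r -> `|q - q0| < r -> near_solution e x q.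
Proof.
move=> e0 S0 cq.
have [S [C [r1 [SJ C0 r10 est]]]] := local_projection_bound f_C1 h_C1 v true S0.1 cq.
have [r2 r20 sdiff] := sys_strict_diff f_C1 h_C1 v xb q0 (ltr01 : 0 < 1 :> R).
have [L [r3 [L0 r30 lip]]] := @fun_of_lipschitz _ _ _ _ f h f_C1 h_C1 (xb, q0).
pose rho := e / (4 * C).
have rho0 : 0 < rho by rewrite divr_gt0 // mulr_gt0.
have /nbhs_ballP [r4 /= r40 resid_le] := near_residual rho0.
pose r := Num.min (Num.min r1 r2) (Num.min r3 r4).
have r0 : 0 < r by rewrite !lt_min r10 r20 r30 r40.
have [rr1 [rr2 [rr3 rr4]]] : r <= r1 /\ r <= r2 /\ r <= r3 /\ r <= r4.
  by rewrite /r !ge_min !lexx !orbT.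
have r20' : 0 < r / 2 by rewrite divr_gt0.
have r2r : r / 2 <= r by move: r0; lra.
exists (r / 2) => // x q xr qr Sq qmin; rewrite ltNge; apply/negP => ed.
set d := enorm (q - yb) in ed; have dpos : 0 < d by apply: lt_le_trans ed.
have {}xr : `|x - xb| < r by apply: lt_le_trans r2r.
have m0 : 0 < m.+1%:R :> R by rewrite ltr0n.
have L10 : 0 < L + 1 by rewrite addr_gt0.
have res i : (i \in ineqs p l true -> sys f h v i x yb <= rho) /\
    (i \in Jset p l -> `|sys f h v i x yb| <= rho).
  apply: resid_le; rewrite -ball_normE /= distrC.
  exact: lt_le_trans rr4.
(* The last bound makes [L * eta + eta <= rho]: the change of [sys] from [q] to [z] plus the
   linearization error. *)
pose eta := Num.min (r / 2) (Num.min (d / (4 * m.+1%:R)) (rho / (L + 1))).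
have eta0 : 0 < eta by rewrite !lt_min !divr_gt0 ?mulr_gt0.
have [er [ed' eL]] : eta <= r / 2 /\ eta <= d / (4 * m.+1%:R) /\ eta <= rho / (L + 1).
  by rewrite /eta !ge_min !lexx !orbT.
have solq : solset l f h v true x q by apply/(solset_Ssol _ Sq).
have qmin' w : solset l f h v true x w -> enorm (q - yb) <= enorm (w - yb).
  by move=> /(solset_Ssol _ Sq); exact: qmin.
have qr' : `|q - q0| < r by apply: lt_le_trans r2r.
have er1 : eta <= r1 by apply: le_trans er _; apply: le_trans r2r _.
have d0 : d != 0 by rewrite gt_eqF.
have [z zq zP] := est x yb q eta (lt_le_trans xr rr1) (lt_le_trans qr' rr1) solq qmin'
  eta0 er1 d0 ed'.
have zqn : `|z - q| < eta := le_lt_trans (norm_le_enorm (z - q)) zq.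
have zr : `|z - q0| < r.
  by rewrite -(subrKA q) (le_lt_trans (ler_normD _ _)) //; move: zqn er qr; lra.
have dist_pair (u : 'rV[R]_m) : `|u - q0| < r -> `|(x, u) - (xb, q0)| < r3.
  by move=> ur; rewrite prod_normE gt_max (lt_le_trans xr rr3) (lt_le_trans ur rr3).
have zqL i : `|sys f h v i x z - sys f h v i x q| <= L * eta.
  rewrite sysB; apply: le_trans (lip i _ _ (dist_pair _ zr) (dist_pair _ qr')) _.
  by rewrite ler_pM2l // prod_normE /= subrr normr0 ge_max (ltW eta0) ltW.
have L_eta : L * eta + eta <= rho.
  by rewrite -[X in _ + X]mul1r -mulrDl mulrC -ler_pdivlMr.
have grad_zq i : `|dotv (gradS f h x z i) (z - q)| <= rho.
  have := sdiff i x z q z (lt_le_trans xr rr2) (lt_le_trans zr rr2)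
    (lt_le_trans qr' rr2) (lt_le_trans zr rr2).
  move: (zqL i) (ltW zqn) L_eta; rewrite !ler_norml mul1r => /andP[H1 H2] H3 H4 /andP[H5 H6].
  by apply/andP; split; lra.
have split_dot i : dotv (gradS f h x z i) (yb - q) =
    dotv (gradS f h x z i) (yb - z) + dotv (gradS f h x z i) (z - q).
  by rewrite -dotvDr subrKA.
(* An inequality costs [rho] for the residual and [rho] for the move from [q] to [z]; an equality
   also pays for its value at [z], at most [L * eta]. *)
have : d <= C * (3 * rho).
  apply: zP => [|i iA zi|j jS]; first by rewrite mulr_ge0 // ltW.
    have H1 := sys_convex_grad f_C1 h_C1 f_convex h_convex v x yb z iA.
    have H2 := (res i).1 iA; have := grad_zq i; rewrite split_dot ler_norml => /andP[_ H3].
    by lra.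
  have jJ : j \in Jset p l by move/fintype.subsetP: SJ; apply.
  have H2 := (res j).2 jJ; have H3 := grad_zq j; have := zqL j.
  rewrite (solq.2 j jJ) subr0 split_dot (sys_affine_grad f_C1 h_C1 h_affine v x yb z jJ) => H4.
  move: H2 H3 H4 eta0 L_eta; rewrite !ler_norml => /andP[? ?] /andP[? ?] /andP[? ?] ? ?.
  by apply/andP; split; lra.
have -> : C * (3 * rho) = 3 / 4 * e by rewrite /rho; field; rewrite gt_eqF.
by move: ed e0; lra.
Qed.

Hypothesis bounded : locally_bounded l h xb.
Hypothesis cq : forall y, Ssol l f h xb y -> RCPLD l f h xb y.

(** Near each point of the compact ball containing the feasible sets, [near_solution] holds: by the
    estimate at points of [Ssol xb], vacuously elsewhere. Compactness gives one neighborhood of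
    [xb], on which the projection of [yb] is the required solution. *)
Lemma convex_isc : isc_at l f h xb yb.
Proof.
move=> e e0; have [M [V [nV VM]]] := bounded.
have nearM : \forall x \near xb, forall y, Gam l h x y -> enorm y <= M.
  by apply: filterS nV => x; exact: VM.
pose D := [set q : 'rV[R]_m | enorm (q - 0) <= M].
have cD : compact D.
  apply: bounded_closed_compact; first exact: (@bounded_near_pt _ _ _ 0 M).
  exact/closed_le_fun/enorm_dist_continuous.
have near_cover : \forall x \near xb, D `<=` near_solution e x.
  have FF : Filter (nbhs xb) := nbhs_filter xb.
  apply: ((compact_near_coveringP D).1 cD _ (nbhs xb) (near_solution e) FF) => q0 _.
  suff [r r0 rP] : exists2 r, 0 < r & forall x q, `|x - xb| < r -> `|q - q0| < r ->
      near_solution e x q.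
    exists (ball q0 r, ball xb r); first by split; exact: nbhsx_ballx.
    by move=> [q x] [/=]; rewrite -!ball_normE /= !(distrC _ q) !(distrC _ x) => qr xr; exact: rP.
  have [S0|nS] := pselect (Ssol l f h xb q0); first exact: near_solution_at (cq S0).
  have /nbhs_ballP [r /= r0 rP] := not_Ssol_near nS.
  exists r => // x q xr qr Sq; case: (rP (x, q)) => //.
  by split; rewrite -ball_normE /= distrC.
apply: filterS (filterI nearM (filterI (near_Ssol_nonempty nearM) near_cover)).
move=> x [GM [[s0 Ss0] cover]].
have solE : Ssol l f h x = solset l f h v true x.
  by apply/seteqP; split => y /(solset_Ssol _ Ss0).
have [|q Sq qmin] := @nearest_point R m (Ssol l f h x) yb (ex_intro _ s0 Ss0).
  by rewrite solE; exact: solset_closed.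
exists q => //; apply: le_lt_trans (norm_le_enorm _) _.
by apply: cover => //; rewrite /D /= subr0; apply: GM; case: Sq.
Qed.

End Convex_isc.

Unset Implicit Arguments. Set Strict Implicit. Set Printing Implicit Defensive.

Theorem theorem4p8 (R : realType) (n m p l : nat)
  (f : 'rV[R]_n * 'rV[R]_m -> R) (h : 'I_p -> 'rV[R]_n * 'rV[R]_m -> R)
  (lp : (l <= p)%N)
  (f_C1 : C1 f) (h_C1 : forall i, C1 (h i))
  (xb : 'rV[R]_n) (xb_dom : domGam l h xb) :
  ( (* (a) *)
    (forall x, convex_in (fun y => f (x, y))) ->
    (forall x (i : 'I_p), (i < l)%N -> convex_in (fun y => h i (x, y))) ->
    (forall x (i : 'I_p), (l <= i)%N -> affine_in (fun y => h i (x, y))) ->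
    locally_bounded l h xb ->
    (forall y, Ssol l f h xb y -> RCPLD l f h xb y) ->
    phi l f h x @[x --> xb] --> phi l f h xb ->
    forall y, Ssol l f h xb y -> Rregular l f h xb y /\ Aubin l f h xb y )
  /\
  ( (* (b) *)
    forall yb, Ssol l f h xb yb ->
      inner_sc l f h xb yb -> RCPLD l f h xb yb ->
      Rregular l f h xb yb /\ Aubin l f h xb yb ).
Proof.
split=> [f_conv h_conv h_aff bnd cq phi_cont y Sy|yb Sb /inner_sc_isc isc cq].
  have isc := convex_isc f_C1 h_C1 f_conv h_conv h_aff Sy phi_cont bnd cq.
  have cqy := cq y Sy.
  by split; [exact: isc_Rregular|exact: isc_Aubin].
by split; [exact: isc_Rregular|exact: isc_Aubin].
Qed.
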